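(* Let $\mathbf G=\{G_N\}_{N\geq1}$ be a sequence of simple graphs, $G_N=(V_N,E_N)$ with $|V_N|=N$, such that there exists a fixed integer $M<\infty$ with $$\limsup_{N\to\infty}\frac{\#\{v\in V_N:d_v\leq M\}}{N}>0,$$ where $d_v$ is the degree of $v$. Then $\mathbf G$ is not $N$-optimal.
   Context: Load balancing system on a graph: vertices of $G_N$ are servers with queues of buffer capacity $b$ (possibly infinite); tasks arrive at each server as independent Poisson processes of rate $\lambda$, processing times i.i.d. unit-mean exponential; a task arriving at $v$ is assigned to a shortest queue in $\{v\}\cup\{\text{neighbors of }v\}$, ties uniformly at random. $Q_i(G_N,t)$ is the number of servers with at least $i$ tasks and $q_i(G_N,t)=Q_i(G_N,t)/N$. For cliques $K_N$ (Join-the-Shortest-Queue), for $\lambda<1$, $(q_i(K_N,\cdot))_{i\ge1}$ converges weakly on finite time intervals to a deterministic fluid limit $(q_i(\cdot))_{i\ge1}$. $\mathbf G$ is $N$-optimal if for every $\lambda<1$ and on any finite time interval, $(q_i(G_N,\cdot))_{i\ge1}$ converges weakly to this same limit process (from the same initial conditions). *)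

(* Defs.v *)
From HB Require Import structures.
From mathcomp Require Import all_boot all_order all_algebra.
From mathcomp Require Import all_classical all_reals all_analysis.
Set Implicit Arguments. Unset Strict Implicit. Unset Printing Implicit Defensive.
Import Order.TTheory GRing.Theory Num.Theory.
Import numFieldNormedType.Exports.
Local Open Scope classical_set_scope.
Local Open Scope ring_scope.

Definition simple_graph (N : nat) (G : rel 'I_N) : Prop :=
  symmetric G /\ irreflexive G.

Definition degree (N : nat) (G : rel 'I_N) (v : 'I_N) : nat := #|[set w | G v w]|.

Definition frac_low_degree (G : forall N, rel 'I_N) (M N : nat) (R : realType) : R :=
  #|[set v : 'I_N | (degree (G N) v <= M)%N]|%:R / N%:R.

(* The clique K_N (Join-the-Shortest-Queue). *)
Definition clique (N : nat) : rel 'I_N := fun v w => v != w.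

(* Buffers: [None] = infinite buffer, [Some c] = buffer capacity c.         *)
Definition fits (b : option nat) (n : nat) : bool :=
  if b is Some c then (n <= c)%N else true.

Definition state (N : nat) := {ffun 'I_N -> nat}.

Definition qfrac (R : realType) (N : nat) (i : nat) (x : state N) : R :=
  #|[set v : 'I_N | (i <= x v)%N]|%:R / N%:R.

Definition nbhd (N : nat) (G : rel 'I_N) (v w : 'I_N) : bool := (w == v) || G v w.

(* Arrival of a task at server v: it joins a shortest queue among nbhd v,   *)
(* ties broken using the uniform [0,1) variable u; the task is lost if that *)
(* shortest queue is full.                                                  *)
Definition arrive (R : realType) (N : nat) (G : rel 'I_N) (b : option nat)
    (x : state N) (v : 'I_N) (u : R) : state N :=
  let cands0 := [seq w <- enum 'I_N | nbhd G v w] in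
  let m := foldr minn (x v) [seq x w | w <- cands0] in
  let cands := [seq w <- cands0 | x w == m] in
  let w := nth v cands (Num.truncn (u * (size cands)%:R)) in
  if fits b m.+1 then [ffun y => if y == w then (x y).+1 else x y] else x.

Definition depart (N : nat) (x : state N) (v : 'I_N) : state N :=
  [ffun y => if y == v then (x y).-1 else x y].

(* One event of the uniformized chain (total event rate N(lambda+1)):      *)
(* u1 selects the server uniformly, u2 decides arrival (prob lambda/(1+lambda)) *)
(* vs potential departure, u3 is the tie breaker.                           *)
Definition step (R : realType) (N : nat) (G : rel 'I_N) (b : option nat)
    (lam : R) (x : state N) (u1 u2 u3 : R) : state N :=
  match (insub (Num.truncn (u1 * N%:R)) : option 'I_N) with
  | Some v => if u2 < lam / (lam + 1) then arrive G b x v u3 else depart x v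
  | None => x
  end.

(* Driving randomness: xi (4k) gives the k-th inter-event time,            *)
(* xi (4k+1), xi (4k+2), xi (4k+3) the marks of the (k+1)-th event.         *)
Fixpoint chain (R : realType) (T : Type) (N : nat) (G : rel 'I_N) (b : option nat)
    (lam : R) (xi : nat -> T -> R) (x0 : state N) (n : nat) (w : T) : state N :=
  match n with
  | 0 => x0
  | n'.+1 => step G b lam (chain G b lam xi x0 n' w)
                 (xi (4 * n').+1 w) (xi (4 * n').+2 w) (xi (4 * n').+3 w)
  end.

(* time of the n-th event (Exp(N(lambda+1)) inter-event times) *)
Definition event_time (R : realType) (T : Type) (N : nat) (lam : R)
    (xi : nat -> T -> R) (n : nat) (w : T) : R :=
  \sum_(k < n) (- ln (xi (4 * k)%N w)) / (N%:R * (lam + 1)).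

Definition nevents (R : realType) (T : Type) (N : nat) (lam : R)
    (xi : nat -> T -> R) (t : R) (w : T) : nat :=
  xget 0%N [set n | event_time N lam xi n w <= t < event_time N lam xi n.+1 w].

Definition qproc (R : realType) (T : Type) (N : nat) (G : rel 'I_N) (b : option nat)
    (lam : R) (xi : nat -> T -> R) (x0 : state N) (i : nat) (t : R) (w : T) : R :=
  qfrac R i (chain G b lam xi x0 (nevents N lam xi t w) w).

(* xi is an i.i.d. sequence of Uniform[0,1] random variables on P: its       *)
(* finite-dimensional joint distribution functions are those of i.i.d.     *)
(* uniforms.                                                                *)
Definition clamp01 (R : realType) (a : R) : R := Num.max 0 (Num.min a 1).

Definition iid_uniform (R : realType) (d : measure_display) (T : measurableType d)
    (P : probability T R) (xi : nat -> T -> R) : Prop :=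
  (forall k, measurable_fun setT (xi k)) /\
  forall (F : seq nat) (a : nat -> R), uniq F ->
    P [set w | forall k, k \in F -> xi k w <= a k] = (\prod_(k <- F) clamp01 (a k))%:E.

Definition conv_fluid (R : realType) (d : measure_display) (T : measurableType d)
    (P : probability T R) (qN : nat -> nat -> R -> T -> R) (q : nat -> R -> R) : Prop :=
  forall (i : nat) (tmax eps delta : R), 0 <= tmax -> 0 < eps -> 0 < delta ->
    \forall N \near \oo,
      (P [set w | exists t : R, (0 <= t <= tmax)%R /\ (eps < `|qN N i t w - q i t|)%R] <= delta%:E)%E.

Definition N_optimal (R : realType) (b : option nat) (G : forall N, rel 'I_N) : Prop :=
  forall lam : R, 0 < lam < 1 ->
  forall (d : measure_display) (T : measurableType d) (P : probability T R)
         (xi : nat -> T -> R), iid_uniform P xi ->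
  forall (x0 y0 : forall N, state N) (q0 : nat -> R) (q : nat -> R -> R),
    (forall N v, fits b (x0 N v)) -> (forall N v, fits b (y0 N v)) ->
    (forall i, (fun N => qfrac R i (x0 N)) @ \oo --> q0 i) ->
    (forall i, (fun N => qfrac R i (y0 N)) @ \oo --> q0 i) ->
    (forall i, continuous (q i)) ->
    conv_fluid P (fun N i t w => qproc (@clique N) b lam xi (y0 N) i t w) q ->
    conv_fluid P (fun N i t w => qproc (G N) b lam xi (x0 N) i t w) q.

(* Main.v *)
(** At lambda = 1/2 the Join-the-Shortest-Queue fluid limit has the fixed point q_1 = 1/2,
    q_i = 0 for i >= 2. On the clique, started with half of the servers holding one task,
    (Q_1 - N/2)^2 has drift at most 1 per event, hence is O(N) after O(N) events; as Q_1
    moves by at most 1 per event, a union bound over finitely many times upgrades this to a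
    uniform estimate, and no server gets a second task as long as Q_1 < N.

    On G, let a set S of linearly many low-degree servers have size at most N / (2(M + 1)),
    and start with N/2 busy servers that include all the neighborhoods of S. During a small
    multiple eta N of events few of these neighborhoods get an idle server, so arrivals at
    them do not increase Q_1, whereas departures decrease Q_1 at the rate of the fixed point.
    Hence E Q_1 / N drops below 1/2 by an amount of order eta |S| / N - O(eta^2), although
    the initial occupancies are asymptotically the same. *)
Require Import Defs.
From HB Require Import structures.
From mathcomp Require Import all_boot all_order all_algebra.
From mathcomp Require Import all_classical all_reals all_analysis.
From mathcomp Require Import measurable_realfun.
From mathcomp Require Import ring lra zify.
Set Implicit Arguments. Unset Strict Implicit. Unset Printing Implicit Defensive.
Import Order.TTheory GRing.Theory Num.Theory.
Import numFieldNormedType.Exports.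
Local Open Scope ring_scope.
Local Open Scope classical_set_scope.

(** * Independent families of events *)

(** [N_optimal] speaks of every probability space carrying an i.i.d. uniform sequence, so refuting
    it requires producing one. Its measure must be monotone on arbitrary sets, because the
    exceptional set of [conv_fluid] ranges over uncountably many times. Since [conv_fluid] controls
    all times at once, the deviation on [G] may be observed at the random time of event [k]. The
    deficit on [G] is known only in expectation. Markov's inequality turns it into an event of
    probability of order [gap], which is small but independent of [N], and this already contradicts
    convergence. The bound on the size of [S] comes from closed neighborhoods having at most [M + 1]
    servers: together they fit among the [N/2] busy ones. The quadratic loss collects new idle
    servers in these neighborhoods, second tasks and the decrease of [Q_1] itself. *)

Section Pr.
Context {d : measure_display} {T : measurableType d} {R : realType}.
Variable P : probability T R.

Definition pr (A : set T) : R := fine (P A).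

Lemma prE A : measurable A -> P A = (pr A)%:E.
Proof. by move=> mA; rewrite /pr fineK// fin_num_measure. Qed.

Lemma pr_ge0 A : 0 <= pr A.
Proof. exact: fine_ge0. Qed.

Lemma prT : pr setT = 1.
Proof. by rewrite /pr probability_setT. Qed.

Lemma prU A B : measurable A -> measurable B -> A `&` B = set0 ->
  pr (A `|` B) = pr A + pr B.
Proof.
move=> mA mB AB; rewrite /pr measureU// fineD ?fin_num_measure//.
Qed.

Lemma pr_split C A : measurable C -> measurable A ->
  pr C = pr (C `&` A) + pr (C `\` A).
Proof.
move=> mC mA; rewrite -prU ?setUIDK//.
- exact: measurableI.
- exact: measurableD.
- by rewrite -subset0 => x [[_ ?] [_ ?]].
Qed.

Lemma pr_le A B : measurable A -> measurable B -> A `<=` B -> pr A <= pr B.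
Proof.
move=> mA mB AB; rewrite -lee_fin -!prE//.
by apply: le_measure => //; rewrite inE.
Qed.

Lemma pr_le1 A : measurable A -> pr A <= 1.
Proof. by move=> mA; rewrite -prT; apply: pr_le. Qed.

Lemma prC A : measurable A -> pr (~` A) = 1 - pr A.
Proof. by move=> mA; rewrite -prT (pr_split measurableT mA) setTI setTD addrC addKr. Qed.

Lemma pr_setU A B : measurable A -> measurable B -> pr (A `|` B) <= pr A + pr B.
Proof.
move=> mA mB; rewrite (pr_split (measurableU _ _ mA mB) mA) setUK lerD2l.
by apply: pr_le => //; [apply: measurableD => //; exact: measurableU|move=> x [[]]].
Qed.

Lemma pr_bigsetU {I : Type} (s : seq I) (F : I -> set T) :
  (forall i, measurable (F i)) ->
  pr (\big[setU/set0]_(i <- s) F i) <= \sum_(i <- s) pr (F i).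
Proof.
move=> mF; elim: s => [|i s IH]; first by rewrite !big_nil /pr measure0.
rewrite !big_cons; apply: le_trans (pr_setU _ _) _ => //.
  by apply: bigsetU_measurable.
by rewrite lerD2l.
Qed.

Lemma pr_fin_partition {I : finType} (f : T -> I) (C : set T) :
  (forall i, measurable (f @^-1` [set i])) -> measurable C ->
  pr C = \sum_i pr (C `&` f @^-1` [set i]).
Proof.
move=> mf mC.
have H (s : seq I) : uniq s ->
    pr (C `&` [set w | f w \in s]) = \sum_(i <- s) pr (C `&` f @^-1` [set i]) /\
    measurable [set w | f w \in s].
  elim: s => [|i s IH] /=.
    rewrite big_nil (_ : [set w | _] = set0) ?setI0 /pr ?measure0//.
    by apply/seteqP; split.
  move=> /andP[ins us]; have [IH1 IH2] := IH us; rewrite big_cons -IH1.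
  have E : [set w | f w \in i :: s] = f @^-1` [set i] `|` [set w | f w \in s].
    apply/seteqP; split => w /=; rewrite inE.
      by case/orP => [/eqP|]; [left|right].
    by case=> [->|->]; rewrite ?eqxx ?orbT.
  rewrite E; split; last exact: measurableU.
  rewrite setIUr prU//; try exact: measurableI.
  apply/seteqP; split => w //= [[_ fi] [_]].
  by rewrite fi (negbTE ins).
have [<- _] := H _ (index_enum_uniq I).
congr pr; apply/seteqP; split => w /=; last by case.
by split => //; rewrite mem_index_enum.
Qed.

(** One outcome is chosen for each index of a finite set. The outcomes at an index need not be
    disjoint, so the same notion covers distribution functions, intervals, digit prefixes and finite
    marks. *)
Definition indep_events {I : eqType} {J : Type}
    (A : I -> J -> set T) (p : I -> J -> R) : Prop :=
  (forall i j, measurable (A i j)) /\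
  forall (F : seq I) (j : I -> J), uniq F ->
    pr (\big[setI/setT]_(i <- F) A i (j i)) = \prod_(i <- F) p i (j i).

(* The events [A i _] can be replaced by the [B i _] one index at a time: when index [i] is
   treated, [C] collects the events already chosen for the other indices. *)
Lemma indep_events_change {I : eqType} {J J' : Type} (j0 : J)
    (A : I -> J -> set T) p (B : I -> J' -> set T) q :
  indep_events A p -> (forall i j, measurable (B i j)) ->
  (forall i j' C, measurable C ->
     (forall j, pr (C `&` A i j) = pr C * p i j) ->
     pr (C `&` B i j') = pr C * q i j') ->
  indep_events B q.
Proof.
move=> [mA hA] mB hB; split => // F j' uF.
suff H : forall F1 F2 (j : I -> J), uniq (F1 ++ F2) ->
    pr (\big[setI/setT]_(i <- F1) B i (j' i) `&` \big[setI/setT]_(i <- F2) A i (j i))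
    = \prod_(i <- F1) q i (j' i) * \prod_(i <- F2) p i (j i).
  by have := H F [::] (fun=> j0); rewrite cats0 !big_nil setIT mulr1; apply.
elim=> [|i F1 IH] F2 j.
  by rewrite /= big_nil setTI big_nil mul1r; exact: hA.
rewrite cat_cons /= mem_cat negb_or => /andP[/andP[i1 i2] u12].
rewrite !big_cons -setIA setIC hB.
- by rewrite IH// mulrC mulrA.
- by apply: measurableI; apply: bigsetI_measurable.
- move=> j1; rewrite IH//.
  pose k := fun x => if x == i then j1 else j x.
  have := IH (i :: F2) k; rewrite !big_cons {1 3}/k eqxx.
  have E2 : \big[setI/setT]_(x <- F2) A x (k x) = \big[setI/setT]_(x <- F2) A x (j x).
    rewrite [LHS]big_seq [RHS]big_seq; apply: eq_bigr => x xF; rewrite /k.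
    by case: eqP => // xi; rewrite -xi xF in i2.
  have E3 : \prod_(x <- F2) p x (k x) = \prod_(x <- F2) p x (j x).
    rewrite [LHS]big_seq [RHS]big_seq; apply: eq_bigr => x xF; rewrite /k.
    by case: eqP => // xi; rewrite -xi xF in i2.
  rewrite E2 E3 (setIC (A i j1)) setIA => ->; first by ring.
  by rewrite uniq_catC /= mem_cat negb_or i1 i2 /= uniq_catC.
Qed.

(** The decoding [g] makes the blocks of original indices disjoint. The list [Ls j] depends on the
    outcome because prefixes of digits have varying length. *)
Lemma indep_events_group {I K L : eqType} {J J' : Type} (Ls : J' -> seq L)
    (e : J' -> L -> J) (f : K -> L -> I) (g : I -> K * L)
    (A : I -> J -> set T) (p : I -> J -> R) :
  (forall k l j, l \in Ls j -> g (f k l) = (k, l)) -> (forall j, uniq (Ls j)) ->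
  indep_events A p ->
  indep_events (fun k j => \big[setI/setT]_(l <- Ls j) A (f k l) (e j l))
               (fun k j => \prod_(l <- Ls j) p (f k l) (e j l)).
Proof.
move=> fK uL [mA hA]; split.
  by move=> k j; apply: bigsetI_measurable.
move=> F j uF; pose j' i := e (j (g i).1) (g i).2.
have := hA [seq f k l | k <- F, l <- Ls (j k)] j' _; rewrite !big_allpairs_dep => H.
transitivity (\prod_(k <- F) \prod_(l <- Ls (j k)) p (f k l) (j' (f k l))); last first.
  by apply: eq_bigr => k _; apply: eq_big_seq => l lL; rewrite /j' (fK _ _ (j k)).
rewrite -H.
  congr pr; apply: eq_bigr => k _; apply: eq_big_seq => l lL.
  by rewrite /j' (fK _ _ (j k)).
apply: allpairs_uniq_dep => // -[k l] [k' l'] /allpairsPdep[a [b [_ bL [-> ->]]]].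
move=> /allpairsPdep[a' [b' [_ bL' [-> ->]]]] /= E.
have := fK a _ _ bL; rewrite E (fK _ _ _ bL') => -[-> ->] //.
Qed.
End Pr.

(** * Fair bits from Lebesgue measure on [0, 1) *)

Lemma truncn_div (R : realType) (x : R) (k : nat) : 0 <= x -> (0 < k)%N ->
  Num.truncn (x / k%:R) = (Num.truncn x %/ k)%N.
Proof.
move=> x0 k0; have k0' : 0 < k%:R :> R by rewrite ltr0n.
apply: truncn_def; rewrite ler_pdivlMr// ltr_pdivrMr// -!natrM.
have /andP[h1 h2] := truncn_itv x0.
apply/andP; split.
  by apply: le_trans h1; rewrite ler_nat leq_divM.
apply: lt_le_trans h2 _; rewrite ler_nat.
by rewrite ltn_ceil.
Qed.

Lemma measurable_truncn {d} {T : measurableType d} {R : realType} (f : T -> R)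
  (X : set nat) : measurable_fun setT f -> measurable [set w | X (Num.truncn (f w))].
Proof.
move=> mf.
have mle n : measurable [set w | (Num.truncn (f w) <= n)%N].
  rewrite (_ : [set w | _] = setT `&` f @^-1` `]-oo, n.+1%:R[).
    exact: mf.
  by apply/seteqP; split => w /=; rewrite in_itv /= truncn_le_nat; [|case].
rewrite (_ : [set w | _] = \bigcup_(m in X) [set w | Num.truncn (f w) = m]).
  apply: bigcup_measurable => m _.
  case: m => [|m].
    rewrite (_ : [set w | _] = [set w | (Num.truncn (f w) <= 0)%N])//.
    by apply/seteqP; split => w /=; rewrite leqn0 => /eqP.
  rewrite (_ : [set w | _] = [set w | (Num.truncn (f w) <= m.+1)%N] `\`
     [set w | (Num.truncn (f w) <= m)%N]).
    exact: measurableD.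
  apply/seteqP; split => w /=.
    by move=> ->; split => //; rewrite ltnn.
  move=> [h1 /negP]; rewrite -ltnNge => h2; apply/eqP.
  by rewrite eqn_leq h1.
by apply/seteqP; split => w /=; [exists (Num.truncn (f w))|case=> m Xm /= ->].
Qed.

Section Unif01.
Variable R : realType.

Definition unif01 : set (measurableTypeR R) -> \bar R :=
  mrestr lebesgue_measure (measurable_itv `[(0 : R), 1[%R).
HB.instance Definition _ := Measure.on unif01.
Lemma unif01_setT : unif01 setT = 1%E.
Proof.
by rewrite /unif01 /mrestr setTI lebesgue_measure_itv /= lte01 oppr0 adde0.
Qed.
HB.instance Definition _ := Measure_isProbability.Build _ _ _ unif01 unif01_setT.

(* This holds for non-measurable sets as well, since [lebesgue_measure] is the outer measure;
   [conv_fluid] measures sets that are not known to be measurable. *)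
Lemma le_unif01 (A B : set R) : A `<=` B -> (unif01 A <= unif01 B)%E.
Proof. by move=> AB; apply: le_mu_ext; apply: setSI. Qed.

Definition bit (n : nat) (w : R) : bool := odd (Num.truncn (2 ^+ n.+1 * w)).

Lemma measurable_bit n b : measurable (bit n @^-1` [set b]).
Proof.
have mf : measurable_fun setT (fun w : R => 2 ^+ n.+1 * w) by exact: mulrl_measurable.
exact: (measurable_truncn [set m | odd m = b] mf).
Qed.

(** The first [n] digits of [w] are those of the integer part of [2 ^+ n * w], so prescribing them
    confines [w] to one dyadic interval. *)
Lemma bits_prefix (b : nat -> bool) n : exists2 m, (m < 2 ^ n)%N &
  forall w : R, 0 <= w < 1 ->
    ((forall i, (i < n)%N -> bit i w = b i) <-> Num.truncn (2 ^+ n * w) = m).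
Proof.
elim: n => [|n [m mn H]].
  exists 0%N => // w /andP[w0 w1]; rewrite mul1r; split => // _.
  by apply: truncn_def; rewrite w0.
exists (m.*2 + b n)%N; first by rewrite expnS; case: (b n); lia.
move=> w w01; have /andP[w0 w1] := w01.
have E : Num.truncn (2 ^+ n * w) = (Num.truncn (2 ^+ n.+1 * w))./2.
  rewrite -divn2 -truncn_div//; last by rewrite mulr_ge0// exprn_ge0.
  by congr Num.truncn; rewrite exprS; field.
split => [h|h].
  have /(H w w01) : forall i, (i < n)%N -> bit i w = b i by move=> i ?; apply: h; lia.
  have := h n (ltnSn _); rewrite /bit E.
  by move: (Num.truncn _) => t <- <-; rewrite addnC odd_double_half.
move=> i; rewrite ltnS leq_eqVlt => /orP[/eqP ->|].
  by rewrite /bit h oddD odd_double oddb.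
move: i; apply/(H w w01); rewrite E h; case: (b n) => /=; lia.
Qed.

Lemma pr_bits_prefix (b : nat -> bool) n :
  pr unif01 (\big[setI/setT]_(i <- iota 0 n) (bit i @^-1` [set b i])) = 2^-1 ^+ n.
Proof.
have [m mn H] := bits_prefix b n.
set C := \big[_/_]_(_ <- _) _.
have -> : pr unif01 C = fine (lebesgue_measure (C `&` `[(0 : R), 1[)) by [].
rewrite /C (_ : _ `&` _ = `[m%:R / 2 ^+ n, m.+1%:R / 2 ^+ n[%classic).
  have lt2 : m%:R / 2 ^+ n < m.+1%:R / 2 ^+ n :> R.
    by rewrite ltr_pM2r ?ltr_nat// invr_gt0 exprn_gt0.
  rewrite lebesgue_measure_itv /= lte_fin lt2 -EFinB /=.
  by rewrite -mulrBl -natrB ?subSn// subnn mul1r exprVn.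
have p2 : 0 < 2 ^+ n :> R by rewrite exprn_gt0.
rewrite -bigcap_seq; apply/seteqP; split => w /=.
  rewrite !in_itv /= ler_pdivrMr// ltr_pdivlMr// => -[h w01].
  have /andP[w0 _] := w01.
  have /(H w w01) <- : forall i, (i < n)%N -> bit i w = b i.
    by move=> i i_n; apply: h => /=; rewrite mem_iota.
  by rewrite ![w * _]mulrC truncn_itv// mulr_ge0// ltW.
rewrite !in_itv /= ler_pdivrMr// ltr_pdivlMr// => /andP[h1 h2].
have w0 : 0 <= w by rewrite -(pmulr_lge0 _ p2); apply: le_trans h1.
have w1 : w < 1.
  rewrite -(ltr_pM2r p2) mul1r; apply: lt_le_trans h2 _.
  by rewrite -natrX ler_nat.
split; last by rewrite w0.
move=> i /=; rewrite mem_iota add0n => /andP[_]; move: i.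
apply/(H w); first by rewrite w0.
by apply: truncn_def; rewrite ![_ ^+ _ * w]mulrC h1.
Qed.

(** Only full prefixes of digits correspond to intervals. A finite set [S1] of digits is completed
    to a prefix by [S2], and the digits of [S2] are then removed one at a time by summing over their
    two values. *)
Lemma indep_bits :
  indep_events unif01 (fun i b => bit i @^-1` [set b]) (fun _ _ => 2^-1).
Proof.
split; first exact: measurable_bit.
suff H n : forall S2 S1 b, perm_eq (S1 ++ S2) (iota 0 n) ->
   pr unif01 (\big[setI/setT]_(i <- S1) (bit i @^-1` [set b i])) =
   \prod_(i <- S1) 2^-1.
  move=> F b uF; pose n := (\max_(i <- F) i).+1.
  apply: (H n [seq i <- iota 0 n | i \notin F]).
  apply: uniq_perm; rewrite ?iota_uniq// ?cat_uniq ?uF ?filter_uniq ?iota_uniq//.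
    by rewrite andbT; apply/hasPn => i; rewrite mem_filter => /andP[].
  move=> i; rewrite mem_cat mem_filter mem_iota add0n /=.
  case: (boolP (i \in F)) => //= iF; apply/esym; rewrite ltnS.
  by apply: leq_bigmax_seq.
elim=> [|s S2 IH] S1 b.
  rewrite cats0 => p; rewrite (perm_big _ p) /= pr_bits_prefix.
  by rewrite big_const_seq count_predT iter_mulr_1 (perm_size p) size_iota.
move=> p.
have u : uniq (S1 ++ s :: S2) by rewrite (perm_uniq p) iota_uniq.
have sS1 : s \notin S1 by move: u; rewrite uniq_catC /= mem_cat negb_or => /andP[/andP[]].
have mC : measurable (\big[setI/setT]_(i <- S1) (bit i @^-1` [set b i])).
  by apply: bigsetI_measurable => i _; exact: measurable_bit.
rewrite (@pr_fin_partition _ _ _ (unif01 : probability _ _) bool (bit s) _ _ mC)//;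
  last by move=> ?; exact: measurable_bit.
have H c : pr unif01 (\big[setI/setT]_(i <- S1) (bit i @^-1` [set b i]) `&`
     bit s @^-1` [set c]) = 2^-1 * \prod_(i <- S1) 2^-1.
  have := IH (s :: S1) (fun i => if i == s then c else b i).
  rewrite !big_cons eqxx => <-; last first.
    by apply: perm_trans p; rewrite perm_sym; apply/permEl; exact: (perm_catCA S1 [:: s] S2).
  rewrite setIC; congr (pr _ (_ `&` _)); apply: eq_big_seq => i iS.
  by case: eqP => // E; rewrite -E iS in sS1.
rewrite big_bool /= !H -mulrDl; set x := \prod_(_ <- _) _.
by lra.
Qed.
End Unif01.

(** * An i.i.d. sequence of uniform variables *)

Fixpoint dig (g : nat -> bool) (n : nat) : nat :=
  if n is n'.+1 then ((dig g n').*2 + g n')%N else 0%N.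

Lemma dig_lt g n : (dig g n < 2 ^ n)%N.
Proof. by elim: n => //= n IH; rewrite expnS; case: (g n); lia. Qed.

Lemma dig_eq n m : (m < 2 ^ n)%N -> exists b : nat -> bool, forall g,
  dig g n = m <-> forall i, (i < n)%N -> g i = b i.
Proof.
elim: n m => [|n IH] m.
  rewrite expn0 ltnS leqn0 => /eqP ->; exists (fun=> true) => g; split => //.
rewrite expnS => mn; have [|b H] := IH m./2; first by lia.
exists (fun i => if i == n then odd m else b i) => g /=; split.
  move=> E i; rewrite ltnS leq_eqVlt; case: eqP => [-> _|_ /= i_n].
    by rewrite -E oddD odd_double oddb.
  move: i i_n; apply/H; rewrite -E; case: (g n) => /=; lia.
move=> h; rewrite (h n)// eqxx.
have /H -> : forall i, (i < n)%N -> g i = b i.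
  by move=> i i_n; have := h i (ltnW i_n); rewrite (ltn_eqF i_n).
by rewrite addnC odd_double_half.
Qed.

Section Num.
Variable R : realType.
Implicit Types g : nat -> bool.

Definition binreal (g : nat -> bool) : R :=
  sup [set (dig g n)%:R / 2 ^+ n | n in [set: nat]].

Lemma dig_lower g n m : (n <= m)%N ->
  (dig g n)%:R / 2 ^+ n <= (dig g m)%:R / 2 ^+ m :> R.
Proof.
move=> /subnKC <-; elim: (m - n)%N => [|k IH]; first by rewrite addn0.
apply: le_trans IH _; rewrite addnS /= exprS ler_pdivrMr ?exprn_gt0//.
rewrite mulrAC ler_pdivlMr; last by rewrite mulr_gt0// exprn_gt0.
rewrite mulrA ler_pM2r ?exprn_gt0// -natrM ler_nat.
by rewrite mulnC mul2n leq_addr.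
Qed.

Lemma dig_upper g n m : (n <= m)%N ->
  (dig g m).+1%:R / 2 ^+ m <= (dig g n).+1%:R / 2 ^+ n :> R.
Proof.
move=> /subnKC <-; elim: (m - n)%N => [|k IH]; first by rewrite addn0.
apply: le_trans IH; rewrite addnS /= exprS ler_pdivrMr; last by rewrite mulr_gt0// exprn_gt0.
rewrite mulrAC ler_pdivlMr ?exprn_gt0//.
rewrite mulrA ler_pM2r ?exprn_gt0// -natrM ler_nat.
case: (g _) => /=; lia.
Qed.

Lemma binreal_ub g n : forall x, [set (dig g n)%:R / 2 ^+ n | n in [set: nat]] x ->
  x <= (dig g n).+1%:R / 2 ^+ n :> R.
Proof.
move=> _ [m _ <-].
apply: le_trans (dig_lower g (leq_maxl m n)) _.
apply: le_trans (dig_upper g (leq_maxr m n)).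
by rewrite ler_pM2r ?invr_gt0 ?exprn_gt0// ler_nat.
Qed.

Lemma binreal_itv g n : (dig g n)%:R / 2 ^+ n <= binreal g <= (dig g n).+1%:R / 2 ^+ n.
Proof.
apply/andP; split.
  apply: ub_le_sup; last by exists n.
  by exists ((dig g n).+1%:R / 2 ^+ n); apply: binreal_ub.
apply: ge_sup; first by exists ((dig g 0)%:R / 2 ^+ 0), 0%N.
exact: binreal_ub.
Qed.

Lemma binreal_leP g a : binreal g <= a <-> forall n, (dig g n)%:R / 2 ^+ n <= a.
Proof.
split => [h n|h].
  by apply: le_trans h; have /andP[] := binreal_itv g n.
apply: ge_sup; first by exists ((dig g 0)%:R / 2 ^+ 0), 0%N.
by move=> _ [n _ <-].
Qed.

End Num.

Section Xi.
Variable R : realType.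
Local Notation P := (@unif01 R).

(** A pairing of the naturals deals out the digits of a single uniform variable to countably many
    variables, which therefore use disjoint sets of digits. *)
Definition xicode (k i : nat) : nat := pickle (k, i).
Definition xidecode (n : nat) : nat * nat := odflt (0, 0)%N (unpickle n).
Lemma xicodeK k i : xidecode (xicode k i) = (k, i).
Proof. by rewrite /xidecode /xicode pickleK. Qed.

Definition xidig (k n : nat) (w : R) : nat := dig (fun i => bit (xicode k i) w) n.

(* The values 0 and 1, of probability 0, are avoided so that the logarithms below are negative. *)
Definition xi (k : nat) (w : R) : R :=
  let x := binreal R (fun i => bit (xicode k i) w) in
  if 0 < x < 1 then x else 2^-1.

Lemma xi_itv k w : 0 < xi k w < 1.
Proof. by rewrite /xi; case: ifP => // _; apply/andP; split; lra. Qed.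

Lemma measurable_xidig k n m : measurable [set w : R | xidig k n w = m].
Proof.
rewrite /xidig; case: (ltnP m (2 ^ n)) => mn.
  have [b H] := dig_eq mn.
  rewrite (_ : [set w : R | _] =
      \big[setI/setT]_(i <- iota 0 n) (bit (xicode k i) @^-1` [set b i])).
    by apply: bigsetI_measurable => i _; exact: measurable_bit.
  rewrite -bigcap_seq; apply/seteqP; split => w /=.
    by move/H => h i /=; rewrite mem_iota => /andP[_]; exact: h.
  by move=> h; apply/H => i i_n; apply: h => /=; rewrite mem_iota.
rewrite (_ : [set w | _] = set0); first exact: measurable0.
rewrite -subset0 => w /= E; move: mn; rewrite -E leqNgt.
by move/negP; apply; exact: dig_lt.
Qed.

Lemma measurable_xidig_set k n (X : set nat) : measurable [set w : R | X (xidig k n w)].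
Proof.
rewrite (_ : [set w | _] = \bigcup_(m in X) [set w | xidig k n w = m]).
  by apply: bigcup_measurable => m _; exact: measurable_xidig.
by apply/seteqP; split => w /=; [exists (xidig k n w)|case=> m Xm /= ->].
Qed.

Lemma measurable_xi k : measurable_fun setT (xi k).
Proof.
have mle (a : R) : measurable [set w : R | binreal R (fun i => bit (xicode k i) w) <= a].
  rewrite (_ : [set w | _] = \bigcap_n [set w | (xidig k n w)%:R / 2 ^+ n <= a]).
    apply: bigcap_measurable => // n _.
    exact: (measurable_xidig_set k n [set m | m%:R / 2 ^+ n <= a]).
  apply/seteqP; split => w /=.
    by move/binreal_leP => h n _; exact: h.
  by move=> h; apply/binreal_leP => n; exact: h.
have mb : measurable_fun setT (fun w : R => binreal R (fun i => bit (xicode k i) w)).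
  move=> mD; apply: (measurability _ (RGenOInfty.measurableE R)) => //.
  move=> _ [_ [x ->] <-]; rewrite setTI.
  rewrite [X in measurable X](_ : _ = ~` [set w : R | binreal R (fun i => bit (xicode k i) w) <= x]).
    exact: measurableC.
  apply/seteqP; split => w /=; rewrite in_itv /= andbT ltNge; first by move/negP.
  by move=> h; apply/negP.
apply: measurable_fun_ifT => //.
by apply: measurable_and; exact: measurable_fun_ltr.
Qed.

Lemma indep_xi : indep_events P (fun k a => [set w | xi k w <= a]) (fun _ a => clamp01 a).
Proof.
pose Ls (j : nat * (nat -> bool)) := iota 0 j.1.
have H := indep_events_group (Ls := Ls) (fun j => j.2)
   (fun k l _ _ => xicodeK k l) (fun _ => iota_uniq _ _) (indep_bits R).
apply: (indep_events_change (0%N, fun=> true) H) => [k a|k a C mC HC].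
  rewrite -[X in measurable X]setTI (_ : [set w | _] = xi k @^-1` `]-oo, a]).
    exact: measurable_xi.
  by apply/seteqP; split => w /=; rewrite in_itv.
have mxi : measurable [set w | xi k w <= a].
  rewrite -[X in measurable X]setTI (_ : [set w | _] = xi k @^-1` `]-oo, a]).
    exact: measurable_xi.
  by apply/seteqP; split => w /=; rewrite in_itv.
have mI A : measurable A -> measurable (C `&` A) by move=> mA; exact: measurableI.
have pe n m : (m < 2 ^ n)%N ->
    pr P (C `&` [set w | xidig k n w = m]) = pr P C * 2^-1 ^+ n.
  move=> mn; have [b Hb] := dig_eq mn; have := HC (n, b).
  rewrite /Ls /= big_const_seq count_predT iter_mulr_1 size_iota => <-.
  congr pr; congr (_ `&` _); rewrite -bigcap_seq; apply/seteqP; split => w /=.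
    by move/Hb => h i /=; rewrite mem_iota => /andP[_]; exact: h.
  by move=> h; apply/Hb => i i_n; apply: h => /=; rewrite mem_iota.
have pl n m : (m <= 2 ^ n)%N ->
    pr P (C `&` [set w | (xidig k n w < m)%N]) = m%:R * (pr P C * 2^-1 ^+ n).
  elim: m => [_|m IH mn].
    rewrite (_ : [set w | _] = set0) ?setI0 /pr ?measure0 ?mul0r//.
    by rewrite -subset0.
  rewrite (_ : [set w | _] =
      [set w | (xidig k n w < m)%N] `|` [set w | xidig k n w = m]).
    rewrite setIUr prU ?IH ?pe// -?natr1.
    - by rewrite mulrDl mul1r.
    - exact: ltnW.
    - by apply: mI; exact: (measurable_xidig_set k n [set x | (x < m)%N]).
    - by apply: mI; exact: measurable_xidig.
    - by rewrite -subset0 => w /= [[_ h] [_ h']]; rewrite h' ltnn in h.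
  apply/seteqP; split => w /=; rewrite ltnS.
    by rewrite leq_eqVlt => /orP[/eqP|]; [right|left].
  by case=> [/ltnW|->].
rewrite /clamp01.
have [a0|a0] := ltP a 0.
  have -> : [set w | xi k w <= a] = set0.
    rewrite -subset0 => w /= h; have /andP[+ _] := xi_itv k w.
    by rewrite ltNge (le_trans h (ltW a0)).
  rewrite setI0 /pr measure0 /= min_l; last by rewrite (le_trans (ltW a0)).
  by rewrite max_l ?mulr0// ltW.
have [a1|a1] := leP 1 a.
  have -> : [set w | xi k w <= a] = setT.
    apply/seteqP; split => // w _ /=.
    by have /andP[_ +] := xi_itv k w; move/ltW/le_trans; apply.
  by rewrite setIT max_r ?mulr1.
rewrite max_r//.
apply/eqP; rewrite eq_sym -subr_eq0 -normr_le0; apply/ler_addgt0Pr => e e0; rewrite add0r.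
have [n hn] : exists n, 4 * 2^-1 ^+ n <= e.
  exists (Num.truncn (4 / e)).+1; set n := _.+1.
  rewrite exprVn ler_pdivrMr ?exprn_gt0// mulrC -ler_pdivrMr//.
  apply: le_trans (ltW (truncnS_gt (4 / e))) _; rewrite -/n -natrX ler_nat ltnW//.
  exact: ltn_expl.
have M0 : 0 <= 2 ^+ n * a by rewrite mulr_ge0// exprn_ge0.
pose M := Num.truncn (2 ^+ n * a).
have /andP[M1 M2] := truncn_itv M0.
have pn : 0 < 2 ^+ n :> R by rewrite exprn_gt0.
have Mn : (M < 2 ^ n)%N.
  rewrite -(ltr_nat R) natrX; apply: le_lt_trans M1 _.
  by rewrite -[ltRHS]mulr1 ltr_pM2l.
(* In the first and last dyadic cells the binary number may be 0 or 1, so that [xi] takes its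
   default value. These two cells and the one containing [a] are the only uncertain ones; they cost
   at most [3 * 2^-n] in either direction. *)
pose Z := [set w | xidig k n w = 0%N] `|` [set w | xidig k n w = (2 ^ n).-1].
have mZ : measurable Z by apply: measurableU; exact: measurable_xidig.
have ml m : measurable [set w | (xidig k n w < m)%N].
  exact: (measurable_xidig_set k n [set x | (x < m)%N]).
have Z0 w : ~ Z w -> xi k w = binreal R (fun i => bit (xicode k i) w).
  move=> nZ; rewrite /xi ifT//.
  have /andP[b1 b2] := binreal_itv R (fun i => bit (xicode k i) w) n.
  have n0 : xidig k n w <> 0%N by move=> h; apply: nZ; left.
  have n1 : xidig k n w <> (2 ^ n).-1 by move=> h; apply: nZ; right.
  apply/andP; split.
    apply: lt_le_trans b1; rewrite divr_gt0// ltr0n lt0n; exact/eqP.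
  apply: le_lt_trans b2 _; rewrite ltr_pdivrMr// mul1r -natrX ltr_nat.
  have := dig_lt (fun i => bit (xicode k i) w) n; move: n1; rewrite /xidig.
  by set a1' := dig _ _; move: (2 ^ n)%N => N2; lia.
have U : pr P (C `&` [set w | xi k w <= a]) <= (M.+1%:R + 2) * (pr P C * 2^-1 ^+ n).
  have -> : (M.+1%:R + 2) * (pr P C * 2^-1 ^+ n) =
     pr P (C `&` [set w | (xidig k n w < M.+1)%N]) +
     (pr P (C `&` [set w | xidig k n w = 0%N]) +
      pr P (C `&` [set w | xidig k n w = (2 ^ n).-1])).
    by rewrite pl// !pe ?expn_gt0// ?prednK ?expn_gt0//; ring.
  have mU : measurable (C `&` [set w | xidig k n w = 0%N] `|`
     C `&` [set w | xidig k n w = (2 ^ n).-1]).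
    by apply: measurableU; apply: mI; exact: measurable_xidig.
  apply: le_trans (lerD (lexx _) (pr_setU _ _ _)); last 2 first.
    by apply: mI; exact: measurable_xidig.
    by apply: mI; exact: measurable_xidig.
  have mM := mI _ (ml M.+1).
  apply: (le_trans _ (pr_setU P mM mU)).
  apply: pr_le => //; [exact: mI|by apply: measurableU => //; exact: mI|].
  move=> w [Cw /= h].
  have [|nZ] := pselect (Z w); first by case=> hz; right; [left|right].
  left; split => //=; rewrite Z0// in h.
  have /andP[b1 _] := binreal_itv R (fun i => bit (xicode k i) w) n.
  rewrite -(ltr_nat R); apply: le_lt_trans M2.
  by rewrite mulrC -ler_pdivrMr//; apply: le_trans h.
have L : (M%:R - 2) * (pr P C * 2^-1 ^+ n) <= pr P (C `&` [set w | xi k w <= a]).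
  have : pr P (C `&` [set w | (xidig k n w < M)%N]) <=
     pr P (C `&` [set w | xi k w <= a]) +
     (pr P (C `&` [set w | xidig k n w = 0%N]) +
      pr P (C `&` [set w | xidig k n w = (2 ^ n).-1])).
    apply: le_trans (lerD (lexx _) (pr_setU _ _ _)); last 2 first.
      by apply: mI; exact: measurable_xidig.
      by apply: mI; exact: measurable_xidig.
    have mU : measurable (C `&` [set w | xidig k n w = 0%N] `|`
       C `&` [set w | xidig k n w = (2 ^ n).-1]).
      by apply: measurableU; apply: mI; exact: measurable_xidig.
    have mM' := mI _ (ml M).
    apply: (le_trans _ (pr_setU P (mI _ mxi) mU)).
    apply: pr_le; [exact: mM'|exact: (measurableU _ _ (mI _ mxi) mU)|].
    move=> w [Cw /= h].
    have [|nZ] := pselect (Z w); first by case=> hz; right; [left|right].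
    left; split => //=; rewrite Z0//.
    have /andP[_ b1] := binreal_itv R (fun i => bit (xicode k i) w) n.
    apply: le_trans b1 _; rewrite ler_pdivrMr// mulrC; apply: le_trans M1.
    by rewrite ler_nat.
  rewrite pl ?(ltnW Mn)// !pe ?expn_gt0// ?prednK ?expn_gt0//.
  set x := _ * 2^-1 ^+ n; set y := pr P _; lra.
have C1 := pr_le1 P mC; have C0 := pr_ge0 P C.
have q0 : 0 < 2^-1 ^+ n :> R by rewrite exprn_gt0// invr_gt0.
have aE : a = (2 ^+ n * a) * 2^-1 ^+ n.
  by rewrite mulrAC exprVn mulfV ?mul1r// gt_eqF.
rewrite -/M in M1 M2.
move: L U; set z := pr P _; set u := pr P C * _ => L U.
have u0 : 0 <= u by rewrite mulr_ge0// ltW.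
have uq : u <= 2^-1 ^+ n by rewrite ler_piMl// ltW.
have E : pr P C * a = (2 ^+ n * a) * u by rewrite {1}aE /u; ring.
have := ler_wpM2r u0 M1; have := ler_wpM2r u0 (ltW M2).
rewrite -natr1 => h1 h2; rewrite -natr1 in U.
apply: le_trans hn; rewrite E ler_distlC; apply/andP; split; nra.
Qed.

Lemma iid_uniform_xi : iid_uniform P xi.
Proof.
split; first exact: measurable_xi.
move=> F a uF; have [mA /(_ F a uF) <-] := indep_xi.
rewrite -prE; last by apply: bigsetI_measurable.
by congr (P _); rewrite -bigcap_seq.
Qed.

End Xi.

Lemma exists_iid_uniform (R : realType) :
  exists (d : measure_display) (T : measurableType d) (P : probability T R)
    (x : nat -> T -> R),
  [/\ (forall A B, A `<=` B -> (P A <= P B)%E), iid_uniform P x &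
      forall k w, 0 < x k w < 1].
Proof.
exists _, _, (@unif01 R), (@xi R); split.
- exact: le_unif01.
- exact: iid_uniform_xi.
- exact: xi_itv.
Qed.

(** * Chains driven by independent marks *)

Section Kernel.
Context {R : realType} {S : Type} {D : finType}.
Variables (wt : D -> R) (phi : S -> D -> S).
Hypothesis wt_ge0 : forall d, 0 <= wt d.
Hypothesis wt_sum : \sum_d wt d = 1.

(** The Markov transition operator. Expectations after [n] steps are its iterates, so drift
    arguments are about finite sums and need no conditional expectation. *)
Definition kop (f : S -> R) (z : S) : R := \sum_d wt d * f (phi z d).

Lemma kop_le f g : (forall z, f z <= g z) -> forall z, kop f z <= kop g z.
Proof. by move=> fg z; apply: ler_sum => d _; rewrite ler_wpM2l. Qed.

Lemma kopD f g z : kop (fun z => f z + g z) z = kop f z + kop g z.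
Proof. by rewrite /kop -big_split; apply: eq_bigr => d _; rewrite mulrDr. Qed.

Lemma kopZ c f z : kop (fun z => c * f z) z = c * kop f z.
Proof. by rewrite /kop mulr_sumr; apply: eq_bigr => d _; rewrite mulrCA. Qed.

Lemma kopC c z : kop (fun=> c) z = c.
Proof. by rewrite /kop -mulr_suml wt_sum mul1r. Qed.

Lemma kop_sum (I : Type) (s : seq I) (f : I -> S -> R) z :
  kop (fun z => \sum_(i <- s) f i z) z = \sum_(i <- s) kop (f i) z.
Proof.
rewrite /kop exchange_big /=; apply: eq_bigr => d _.
by rewrite mulr_sumr.
Qed.

Lemma eq_kop f g : (forall z, f z = g z) -> forall z, kop f z = kop g z.
Proof. by move=> fg z; apply: eq_bigr => d _; rewrite fg. Qed.

Definition kiter n (f : S -> R) : S -> R := iter n kop f.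

Lemma kiterS n f z : kiter n.+1 f z = kiter n (kop f) z.
Proof. by rewrite /kiter iterSr. Qed.

Lemma kiter_le n f g : (forall z, f z <= g z) -> forall z, kiter n f z <= kiter n g z.
Proof. by move=> fg; elim: n => //= n IH z; apply: kop_le. Qed.

Lemma eq_kiter n f g : (forall z, f z = g z) -> forall z, kiter n f z = kiter n g z.
Proof. by move=> fg; elim: n => //= n IH z; apply: eq_kop. Qed.

Lemma kiterD n f g z : kiter n (fun z => f z + g z) z = kiter n f z + kiter n g z.
Proof. by elim: n z => //= n IH z; rewrite -kopD; apply: eq_kop. Qed.

Lemma kiterZ n c f z : kiter n (fun z => c * f z) z = c * kiter n f z.
Proof. by elim: n z => //= n IH z; rewrite -kopZ; apply: eq_kop. Qed.

Lemma kiterC n c z : kiter n (fun=> c) z = c.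
Proof. by elim: n z => //= n IH z; rewrite -[RHS](kopC c z); apply: eq_kop. Qed.

Lemma kiter_sum n (I : Type) (s : seq I) (f : I -> S -> R) z :
  kiter n (fun z => \sum_(i <- s) f i z) z = \sum_(i <- s) kiter n (f i) z.
Proof. by elim: n z => //= n IH z; rewrite -kop_sum; apply: eq_kop. Qed.

(** A discrete Dynkin inequality: the iterates are monotone, additive and preserve constants, so a
    drift bound that holds at every state adds up over the steps. *)
Lemma kiter_drift n f a z :
  (forall z, kop f z <= f z + a) -> kiter n f z <= f z + n%:R * a.
Proof.
move=> h; elim: n => [|n IH]; first by rewrite mul0r addr0.
rewrite kiterS (le_trans (kiter_le n h z))// kiterD kiterC -natr1 mulrDl mul1r addrA.
by rewrite lerD2r.
Qed.

Context {d : measure_display} {T : measurableType d} (P : probability T R).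
Variable mark : nat -> T -> D.
Hypothesis indep_mark :
  indep_events P (fun k x => mark k @^-1` [set x]) (fun _ x => wt x).

Fixpoint zproc (z0 : S) (n : nat) (w : T) : S :=
  if n is n'.+1 then phi (zproc z0 n' w) (mark n' w) else z0.

(** The law of the present state alone would not support the induction. The product over marks of
    index at least [n] records that the future is independent of the present; in each step the mark
    of index [n] passes from the future into the state. Events are boolean predicates since [S]
    carries no measurable structure. *)
Lemma zproc_law_indep z0 n : forall (X : S -> bool),
  measurable [set w | X (zproc z0 n w)] /\
  forall (F : seq nat) (j : nat -> D), uniq F -> all (leq n) F ->
    pr P ([set w | X (zproc z0 n w)] `&` \big[setI/setT]_(i <- F) mark i @^-1` [set j i])
    = kiter n (fun z => (X z)%:R) z0 * \prod_(i <- F) wt (j i).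
Proof.
have [mm hm] := indep_mark.
elim: n => [|n IH] X.
  split => [|F j uF _] /=.
    case: (X z0).
      rewrite (_ : [set _ | _] = setT); first exact: measurableT.
      by apply/seteqP.
    rewrite (_ : [set _ | _] = set0); first exact: measurable0.
    by rewrite -subset0.
  case: (X z0); last first.
    rewrite (_ : [set _ | _] = set0) ?set0I ?mul0r /pr ?measure0//.
    by rewrite -subset0.
  rewrite (_ : [set _ | _] = setT) ?setTI ?hm// ?mul1r//.
  by apply/seteqP.
have E x : [set w | X (zproc z0 n.+1 w)] `&` mark n @^-1` [set x] =
    [set w | X (phi (zproc z0 n w) x)] `&` mark n @^-1` [set x].
  by apply/seteqP; split => w /= [h e]; split => //; move: h; rewrite e.
have mX : measurable [set w | X (zproc z0 n.+1 w)].
  rewrite (_ : [set w | _] = \big[setU/set0]_(x <- index_enum D)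
     ([set w | X (phi (zproc z0 n w) x)] `&` mark n @^-1` [set x])).
    apply: bigsetU_measurable => x _; apply: measurableI; last exact: mm.
    exact: (IH (fun z => X (phi z x))).1.
  apply/seteqP; split => w.
    move=> h; rewrite -bigcup_seq; exists (mark n w); first by rewrite /= mem_index_enum.
    by rewrite -E; split.
  by rewrite -bigcup_seq => -[x _]; rewrite -E => -[].
split => // F j uF aF.
have mF : measurable (\big[setI/setT]_(i <- F) mark i @^-1` [set j i]).
  by apply: bigsetI_measurable.
rewrite (@pr_fin_partition _ _ _ P D (mark n))//; last exact: measurableI.
have nF : n \notin F.
  by apply/negP => /(allP aF); rewrite ltnn.
rewrite kiterS.
transitivity (\sum_x (wt x * kiter n (fun z => (X (phi z x))%:R) z0) * \prod_(i <- F) wt (j i)).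
  apply: eq_bigr => x _; rewrite setIAC E -setIA.
  have := (IH (fun z => X (phi z x))).2 (n :: F) (fun i => if i == n then x else j i).
  rewrite !big_cons eqxx /= nF uF leqnn => /(_ isT) H.
  have E2 : \big[setI/setT]_(i <- F) mark i @^-1` [set if i == n then x else j i] =
            \big[setI/setT]_(i <- F) mark i @^-1` [set j i].
    apply: eq_big_seq => i iF; case: eqP => // e; by rewrite -e iF in nF.
  have E3 : \prod_(i <- F) wt (if i == n then x else j i) = \prod_(i <- F) wt (j i).
    apply: eq_big_seq => i iF; case: eqP => // e; by rewrite -e iF in nF.
  rewrite -E2 H ?E3 1?mulrA ?[wt x * _]mulrC//.
  by apply/allP => i /(allP aF)/ltnW.
rewrite -mulr_suml; congr (_ * _); apply/esym.
rewrite -[RHS](eq_bigr _ (fun x _ => kiterZ n (wt x) (fun z => (X (phi z x))%:R) z0)).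
by rewrite -kiter_sum; apply: eq_kiter.
Qed.

Lemma measurable_zproc z0 n (X : S -> bool) : measurable [set w | X (zproc z0 n w)].
Proof. exact: (zproc_law_indep z0 n X).1. Qed.

Lemma pr_zproc z0 n (X : S -> bool) :
  pr P [set w | X (zproc z0 n w)] = kiter n (fun z => (X z)%:R) z0.
Proof.
(* Weights with sum 1 force [D] to be inhabited, which provides a choice function for the empty list
   of marks. *)
have [x0 _|D0] := pickP (fun _ : D => true); last first.
  by move: wt_sum; rewrite big_pred0// => /esym/eqP; rewrite oner_eq0.
have [_ /(_ [::] (fun=> x0) isT isT)] := zproc_law_indep z0 n X.
by rewrite !big_nil setIT mulr1.
Qed.

Lemma pr_zproc_markov z0 n (X : S -> bool) (V : S -> R) (M : R) : 0 < M ->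
  (forall z, 0 <= V z) -> (forall z, X z -> M <= V z) ->
  pr P [set w | X (zproc z0 n w)] <= kiter n V z0 / M.
Proof.
move=> M0 V0 XV; rewrite pr_zproc mulrC -kiterZ; apply: kiter_le => z.
have : 0 <= M^-1 * V z by rewrite mulr_ge0// invr_ge0 ltW.
case: (boolP (X z)) => // /XV h _.
by rewrite ler_pdivlMl// mulr1.
Qed.

End Kernel.

(** * Intervals and fair coins from joint distribution functions *)

Section Box.
Context {R : realType} {d : measure_display} {T : measurableType d}.
Variables (P : probability T R) (U : nat -> T -> R).
Hypothesis hU : iid_uniform P U.

Lemma clamp01_lip (a b : R) : a <= b -> clamp01 a <= clamp01 b <= clamp01 a + (b - a).
Proof.
move=> ab; rewrite /clamp01.
by have [?|?] := ltP a 1; have [?|?] := ltP b 1; rewrite ?(max_r ler01);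
  have [?|?] := leP 0 a; have [?|?] := leP 0 b; lra.
Qed.

Lemma clamp01_id (a : R) : 0 <= a <= 1 -> clamp01 a = a.
Proof. by move=> /andP[a0 a1]; rewrite /clamp01 min_l// max_r. Qed.

Lemma measurable_U_le k a : measurable [set w | U k w <= a].
Proof.
rewrite -[X in measurable X]setTI (_ : [set w | _] = U k @^-1` `]-oo, a]).
  exact: hU.1.
by apply/seteqP; split => w /=; rewrite in_itv.
Qed.

Lemma measurable_U_lt k a : measurable [set w | U k w < a].
Proof.
rewrite -[X in measurable X]setTI (_ : [set w | _] = U k @^-1` `]-oo, a[).
  exact: hU.1.
by apply/seteqP; split => w /=; rewrite in_itv.
Qed.

Lemma indep_le :
  indep_events P (fun k a => [set w | U k w <= a]) (fun _ a => clamp01 a).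
Proof.
split => [k a|F a uF]; first exact: measurable_U_le.
rewrite /pr -bigcap_seq; have := hU.2 F a uF.
by rewrite (_ : [set w | _] = \bigcap_(i in [set` F]) [set w | U i w <= a i])// => ->.
Qed.

Lemma indep_box :
  indep_events P (fun k (I : R * R) => [set w | I.1 <= U k w < I.2])
    (fun _ I => if I.1 <= I.2 then clamp01 I.2 - clamp01 I.1 else 0).
Proof.
have E k (I : R * R) :
    [set w | I.1 <= U k w < I.2] = [set w | U k w < I.2] `\` [set w | U k w < I.1].
  apply/seteqP; split => w /=.
    by move=> /andP[h1 h2]; split => //; apply/negP; rewrite -leNgt.
  by move=> [h1 /negP]; rewrite -leNgt => ->.
have mB k (I : R * R) : measurable [set w | I.1 <= U k w < I.2].
  by rewrite E; apply: measurableD; exact: measurable_U_lt.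
apply: (indep_events_change 0 indep_le mB) => k [l r] C mC HC /=.
have mI A : measurable A -> measurable (C `&` A) by move=> mA; exact: measurableI.
(* The strict inequality is squeezed between the weak ones at [a - e] and [a]; [clamp01] is
   1-Lipschitz, so the two bounds differ by at most [e]. *)
have HL a : pr P (C `&` [set w | U k w < a]) = pr P C * clamp01 a.
  have C1 := pr_le1 P mC; have C0 := pr_ge0 P C.
  apply/eqP; rewrite -subr_eq0 -normr_le0; apply/ler_addgt0Pr => e e0; rewrite add0r.
  have h1 : pr P (C `&` [set w | U k w < a]) <= pr P C * clamp01 a.
    rewrite -HC; apply: pr_le; try (apply: mI).
      exact: measurable_U_lt.
      exact: measurable_U_le.
    by apply: setIS => w /= /ltW.
  have h2 : pr P C * clamp01 (a - e) <= pr P (C `&` [set w | U k w < a]).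
    rewrite -HC; apply: pr_le; try (apply: mI).
      exact: measurable_U_le.
      exact: measurable_U_lt.
    by apply: setIS => w /= h; apply: le_lt_trans h _; rewrite ltrBlDr ltrDl.
  have /clamp01_lip/andP[h3 h4] : a - e <= a by rewrite lerBlDr lerDl ltW.
  have h5 : pr P C * clamp01 a <= pr P C * clamp01 (a - e) + e.
    apply: le_trans (ler_wpM2l C0 h4) _; rewrite mulrDr lerD2l.
    by rewrite opprB addrC subrK ler_piMl// ltW.
  by rewrite ler_norml; apply/andP; split; lra.
case: ifP => lr; last first.
  rewrite (_ : [set w | _] = set0) ?setI0 ?mulr0 /pr ?measure0//.
  rewrite -subset0 => w /= /andP[h1 /ltW h2].
  by rewrite (le_trans h1 h2) in lr.
rewrite mulrBr -!HL (E k (l, r))//=.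
have := pr_split P (mI _ (measurable_U_lt k r)) (measurable_U_lt k l).
rewrite -setIA (_ : [set w | U k w < r] `&` _ = [set w | U k w < l]).
  by rewrite setIDA => ->; rewrite addrAC subrr add0r.
by apply/seteqP; split => w /= => [[]//|h]; split => //; apply: lt_le_trans h lr.
Qed.

(** A fair coin read off the clock variable of an event: if [u <= 1/2] then
    [- ln u >= 1 - u >= 1/2], so success certifies a waiting term of at least 1/2. *)
Definition half_mark (k : nat) (w : T) : bool := U (4 * k) w <= 2^-1.

Lemma indep_half : indep_events P (fun k b => half_mark k @^-1` [set b]) (fun _ _ => 2^-1).
Proof.
have half01 : 0 <= (2^-1 : R) <= 1 by apply/andP; split; lra.
have mm k b : measurable (half_mark k @^-1` [set b]).
  case: b.
    rewrite (_ : _ @^-1` _ = [set w | U (4 * k)%N w <= 2^-1]); last by apply/seteqP; split => w.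
    exact: measurable_U_le.
  rewrite (_ : _ @^-1` _ = ~` [set w | U (4 * k)%N w <= 2^-1]).
    by apply: measurableC; exact: measurable_U_le.
  by apply/seteqP; split => w; rewrite /half_mark /=; case: (_ <= _).
(* Blocks with a single element merely extract the subsequence of indices [4 * k]. *)
have := @indep_events_group _ _ _ P _ nat nat R R (fun=> [:: 0%N]) (fun a _ => a)
  (fun k _ => (4 * k)%N) (fun i => (i %/ 4, 0)%N) _ _ _ _ indep_le.
move=> H; apply: (indep_events_change 0 (H _ _) mm).
- by move=> k l _; rewrite inE => /eqP ->; rewrite mulKn.
- by [].
move=> k b C mC HC.
have Ht : pr P (C `&` [set w | U (4 * k)%N w <= 2^-1]) = pr P C * 2^-1.
  by have := HC 2^-1; rewrite !big_seq1 clamp01_id.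
case: b.
  by rewrite -Ht; congr pr; congr (_ `&` _); apply/seteqP; split => w.
have := pr_split P mC (measurable_U_le (4 * k) 2^-1); rewrite Ht.
rewrite (_ : C `\` _ = C `&` half_mark k @^-1` [set false]).
  by move: (pr P C) (pr P _) => x y; clear; lra.
apply/seteqP; split => w; rewrite /half_mark /=; first by move=> [? /negP/negbTE ->].
by move=> [? ->].
Qed.
End Box.

(** * The load balancing chain as a chain driven by marks *)

Lemma foldr_minn_le (a : nat) (s : seq nat) c : c \in s -> (foldr minn a s <= c)%N.
Proof.
elim: s => //= y s IH; rewrite inE geq_min => /orP[/eqP ->|/IH ->]; first by rewrite leqnn.
by rewrite orbT.
Qed.

Lemma foldr_minn_mem (a : nat) (s : seq nat) : a \in s -> foldr minn a s \in s.
Proof.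
move=> as_; suff : foldr minn a s \in a :: s by rewrite inE => /orP[/eqP ->|].
elim: s {as_} => [|y s IH] /=; first by rewrite inE.
rewrite /minn; case: ifP => _; first by rewrite !inE eqxx orbT.
by move: IH; rewrite !inE => /orP[->|->] //; rewrite !orbT.
Qed.

Definition incr (N : nat) (x : state N) (w : 'I_N) : state N :=
  [ffun y => if y == w then (x y).+1 else x y].

Section Arrive.
Variables (R : realType) (N : nat) (G : rel 'I_N) (b : option nat).
Implicit Types (x : state N) (v : 'I_N).

Definition cands x v : seq 'I_N :=
  let cands0 := [seq w <- enum 'I_N | nbhd G v w] in
  [seq w <- cands0 | x w == foldr minn (x v) [seq x w | w <- cands0]].

Lemma arriveE x v (u : R) : arrive G b x v u =
  let w := nth v (cands x v) (Num.truncn (u * (size (cands x v))%:R)) in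
  if fits b (foldr minn (x v) [seq x w | w <- [seq w <- enum 'I_N | nbhd G v w]]).+1
  then incr x w else x.
Proof. by []. Qed.

Lemma cands_size x v : (0 < size (cands x v) <= N)%N.
Proof.
apply/andP; split; last first.
  rewrite /cands; apply: leq_trans (size_subseq (filter_subseq _ _)) _.
  by apply: leq_trans (size_subseq (filter_subseq _ _)) _; rewrite size_enum_ord.
rewrite size_filter -has_count; set s := [seq w <- _ | _].
have vs : v \in s by rewrite mem_filter mem_enum /nbhd eqxx.
have /mapP[w ws h] := foldr_minn_mem (map_f x vs).
by apply/hasP; exists w => //; rewrite -h.
Qed.

Lemma arriveP x v (u : R) : 0 <= u < 1 -> exists2 w,
  nbhd G v w /\ (forall w', nbhd G v w' -> (x w <= x w')%N) &
  arrive G b x v u = if fits b (x w).+1 then incr x w else x.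
Proof.
move=> /andP[u0 u1]; rewrite arriveE /=; set m := foldr _ _ _.
have /andP[s0 _] := cands_size x v.
set k := Num.truncn _; set w := nth _ _ _.
have : w \in cands x v.
  apply: mem_nth; rewrite /k truncn_lt_nat ?mulr_ge0//.
  by rewrite gtr_pMl// ltr0n.
rewrite !mem_filter -/m => /andP[/eqP xw /andP[nw _]].
exists w; last by rewrite xw.
split => // w' nw'; rewrite xw; apply: foldr_minn_le; apply: map_f.
by rewrite mem_filter nw' mem_enum.
Qed.

(** If [L = c * s], then truncating [u * s] amounts to truncating [u * L] and dividing by [c]. A
    common multiple [L] of all possible numbers [s] of candidates thus serves every state. *)
Lemma arrive_discrete x v (u : R) (L : nat) : 0 <= u ->
  (forall s, (0 < s <= N)%N -> (s %| L)%N) -> (0 < L)%N ->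
  arrive G b x v u = arrive G b x v ((Num.truncn (u * L%:R))%:R / L%:R : R).
Proof.
move=> u0 HL L0; rewrite !arriveE /=.
have s := cands_size x v; have /andP[s0 _] := s.
have /dvdnP[c hc] := HL _ s.
suff -> : Num.truncn (u * (size (cands x v))%:R) =
   Num.truncn ((Num.truncn (u * L%:R))%:R / L%:R * (size (cands x v))%:R : R) by [].
have c0 : (0 < c)%N by move: L0; rewrite hc muln_gt0 => /andP[].
have sn0 : (size (cands x v))%:R != 0 :> R by rewrite pnatr_eq0 -lt0n.
have cn0 : c%:R != 0 :> R by rewrite pnatr_eq0 -lt0n.
have -> : u * (size (cands x v))%:R = (u * L%:R) / c%:R.
  by rewrite hc natrM; field.
have -> : forall y : R, y / L%:R * (size (cands x v))%:R = y / c%:R.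
  by move=> y; rewrite hc natrM; field; apply/andP; split.
by rewrite !truncn_div// ?natrK ?mulr_ge0//.
Qed.

End Arrive.

Lemma truncn_cell (R : realType) (m : nat) (u : R) (v : 'I_m.+1) : 0 < u < 1 ->
  inord (Num.truncn (u * m.+1%:R)) = v <-> v%:R / m.+1%:R <= u < v.+1%:R / m.+1%:R.
Proof.
move=> /andP[u0 u1].
rewrite ler_pdivrMr// ltr_pdivlMr//.
have um : 0 <= u * m.+1%:R by rewrite mulr_ge0// ltW.
rewrite -truncn_eq//.
have lt : (Num.truncn (u * m.+1%:R) < m.+1)%N.
  by rewrite truncn_lt_nat// gtr_pMl.
split => [<-|/eqP ->]; first by rewrite inordK.
by rewrite inord_val.
Qed.

Section Marks.
Context {R : realType} {d : measure_display} {T : measurableType d}.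
Variables (P : probability T R) (U : nat -> T -> R).
Hypothesis hU : iid_uniform P U.
Hypothesis U_itv : forall k w, 0 < U k w < 1.
Variables (n : nat) (lam : R).
Hypothesis lam0 : 0 < lam.
Let p := lam / (lam + 1).
(** Taking the predecessor lets the factorial appear as a successor, the form of bound that [inord]
    asks for. *)
Let L := ((n.+1)`!).-1.

(* The tie-breaking variable is recorded up to its cell of width 1/N!, which determines the
   selected server whatever the number of candidates is. *)
Definition mark_type : finType := ('I_n.+1 * bool * 'I_(((n.+1)`!).-1).+1)%type.

Definition mark_weight (x : mark_type) : R :=
  (n.+1%:R)^-1 * (if x.1.2 then lam / (lam + 1) else 1 - lam / (lam + 1)) *
  (((n.+1)`!)%:R)^-1.

Definition mark (k : nat) (w : T) : mark_type :=
  (inord (Num.truncn (U (4 * k).+1 w * n.+1%:R)), U (4 * k).+2 w < lam / (lam + 1),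
   inord (Num.truncn (U (4 * k).+3 w * ((((n.+1)`!).-1).+1)%:R))).

Let p01 : 0 < p < 1.
Proof.
rewrite /p divr_gt0 ?addr_gt0//= ltr_pdivrMr ?addr_gt0// mul1r.
by rewrite ltrDl.
Qed.

Lemma mark_weight_ge0 x : 0 <= mark_weight x.
Proof.
have /andP[h0 h1] := p01.
rewrite /mark_weight -/p !mulr_ge0// ?invr_ge0//.
by case: ifP => _; [exact: ltW|rewrite subr_ge0 ltW].
Qed.

Lemma sum_mark_weight (f : 'I_n.+1 -> bool -> R) :
  \sum_(x : mark_type) mark_weight x * f x.1.1 x.1.2 =
  n.+1%:R^-1 * \sum_v (p * f v true + (1 - p) * f v false).
Proof.
pose F (y : 'I_n.+1 * bool) (j : 'I_(((n.+1)`!).-1).+1) := 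
  (n.+1%:R)^-1 * (if y.2 then p else 1 - p) * (((n.+1)`!)%:R)^-1 * f y.1 y.2.
rewrite (eq_bigr (fun x => F x.1 x.2)) //.
rewrite -(pair_bigA _ F) /= /F.
rewrite (eq_bigr (fun y => n.+1%:R^-1 * ((if y.2 then p else 1 - p) * f y.1 y.2))); last first.
  move=> y _; rewrite sumr_const card_ord prednK ?fact_gt0// -mulr_natr.
  have : (n.+1)`!%:R != 0 :> R by rewrite pnatr_eq0 -lt0n fact_gt0.
  move=> h; set a := (n.+1%:R^-1 : R); set c := (if _ then _ else _); set e := f _ _.
  by field; rewrite h andbT addrC natr1 pnatr_eq0.
rewrite -mulr_sumr; congr (_ * _).
rewrite -(pair_bigA _ (fun v bb => (if bb then p else 1 - p) * f v bb)) /=.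
by apply: eq_bigr => v _; rewrite big_bool.
Qed.

Lemma mark_weight_sum : \sum_x mark_weight x = 1.
Proof.
transitivity (\sum_x mark_weight x * 1); first by apply: eq_bigr => x _; rewrite mulr1.
rewrite (sum_mark_weight (fun _ _ => 1)).
rewrite (eq_bigr (fun=> 1)); last by move=> v _; ring.
by rewrite sumr_const card_ord mulVf.
Qed.

Lemma indep_mark : indep_events P (fun k x => mark k @^-1` [set x]) (fun _ x => mark_weight x).
Proof.
(* A mark is a box in the three variables of an event: a cell of width [1 / n.+1] for the server,
   [[0, p)] or [[p, 1)] for the kind of event, and a tie-breaking cell. *)
pose e (x : mark_type) (l : nat) : R * R :=
  if l == 1%N then (x.1.1%:R / n.+1%:R, (x.1.1).+1%:R / n.+1%:R) else
  if l == 2%N then (if x.1.2 then (0, p) else (p, 1)) else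
  (x.2%:R / L.+1%:R, (x.2).+1%:R / L.+1%:R).
have := @indep_events_group _ _ _ P _ nat nat _ mark_type (fun=> [:: 1; 2; 3]%N) e
  (fun k l => (4 * k + l)%N) (fun i => (i %/ 4, i %% 4)%N) _ _ _ _ (indep_box hU).
set A := (fun k j => _); set q := (fun k j => _).
move=> H.
have {}H : indep_events P A q.
  apply: H => // k l _; rewrite !inE => lL.
  have l4 : (l < 4)%N by case/or3P: lL => /eqP ->.
  by rewrite mulnC divnMDl// modnMDl modn_small// divn_small// addn0.
have -> : (fun k x => mark k @^-1` [set x]) = A.
  apply/funext => k; apply/funext => x; rewrite /A !big_cons big_nil setIT.
  rewrite /e /= addn1 addn2 addn3.
  case: x => [[v bb] j]; apply/seteqP; split => w /=.
    move=> [<- <- <-]; split; first exact/truncn_cell.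
    split; last exact/truncn_cell.
    have /andP[h0 h1] := U_itv (4 * k).+2 w.
    by rewrite -/p; case: ltP => h /=; rewrite ?(ltW h0)// ?h.
  move=> [/(truncn_cell _ (U_itv _ _)) h1 [h2 /(truncn_cell _ (U_itv _ _)) h3]].
  rewrite /mark h1 h3; congr (_, _, _); move: h2; rewrite -/p.
  by case: bb => /= /andP[h h']; [|apply/negbTE; rewrite -leNgt].
have -> // : (fun _ x => mark_weight x) = q.
apply/funext => k; apply/funext => -[[v bb] j]; rewrite /q !big_cons big_nil /e /=.
have cell (m : nat) (i : 'I_m.+1) :
    (if i%:R / m.+1%:R <= i.+1%:R / m.+1%:R :> R then
       clamp01 (i.+1%:R / m.+1%:R) - clamp01 (i%:R / m.+1%:R) else 0) = m.+1%:R^-1 :> R.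
  have m0 : 0 < m.+1%:R^-1 :> R by rewrite invr_gt0.
  rewrite ler_pM2r// ler_nat leqnSn !clamp01_id.
  - by rewrite -mulrBl -natrB// subSnn mul1r.
  - by rewrite mulr_ge0 ?(ltW m0)//= ler_pdivrMr// mul1r ler_nat ltnW.
  - by rewrite mulr_ge0 ?(ltW m0)//= ler_pdivrMr// mul1r ler_nat ltn_ord.
have /andP[h0 h1] := p01.
rewrite !cell mulr1 mulrA /mark_weight [X in _ = _ / X%:R]prednK ?fact_gt0//; congr (_ * _ * _).
rewrite -/p; case: bb => /=.
  rewrite ltW// !clamp01_id ?subr0 ?lexx ?ler01//.
  by rewrite !ltW.
rewrite ltW// !clamp01_id ?lexx ?ler01//.
by rewrite !ltW.
Qed.

(** The left end of the recorded cell stands for the tie-breaking variable. *)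
Definition dstep (G : rel 'I_n.+1) (b : option nat) (x : state n.+1) (y : mark_type) : state n.+1 :=
  if y.1.2 then arrive G b x y.1.1 (y.2%:R / ((n.+1)`!)%:R : R) else depart x y.1.1.

Lemma chain_zproc (G : rel 'I_n.+1) b x0 k w :
  chain G b lam U x0 k w = zproc (dstep G b) mark x0 k w.
Proof.
elim: k => //= k ->; rewrite /step /dstep /=.
set x := zproc _ _ _ _ _.
have /andP[h0 h1] := U_itv (4 * k).+1 w.
have lt : (Num.truncn (U (4 * k).+1 w * n.+1%:R) < n.+1)%N.
  by rewrite truncn_lt_nat ?gtr_pMl// mulr_ge0// ltW.
have -> : insub (Num.truncn (U (4 * k).+1 w * n.+1%:R)) =
    Some (inord (Num.truncn (U (4 * k).+1 w * n.+1%:R)) : 'I_n.+1).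
  rewrite insubT; congr Some; apply/val_inj => /=; by rewrite inordK.
case: ifP => // _.
have /andP[h2 h3] := U_itv (4 * k).+3 w.
rewrite [LHS](@arrive_discrete R _ _ _ _ _ _ ((n.+1)`!)) ?fact_gt0 ?ltW//; last first.
  by move=> s ?; apply: dvdn_fact.
congr (arrive _ _ _ _ (_%:R / _)).
rewrite inordK; rewrite prednK ?fact_gt0//.
rewrite truncn_lt_nat ?gtr_pMl ?ltr0n ?fact_gt0//.
by rewrite mulr_ge0// ltW.
Qed.

End Marks.

(** * Occupancy counts and the drift on the clique *)

Definition cnt (N i : nat) (x : state N) : nat := (\sum_v (i <= x v))%N.

Lemma qfrac_cnt (R : realType) (N i : nat) (x : state N) :
  qfrac R i x = (cnt i x)%:R / N%:R.
Proof.
rewrite /qfrac /cnt; congr (_%:R / _).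
rewrite -sum1_card big_mkcond; apply: eq_bigr => v _.
rewrite (_ : (v \in _) = (i <= x v)%N); first by case: (_ <= _)%N.
by apply/idP/idP => [/set_mem//|h]; exact/mem_set.
Qed.

Section Count.
Variable N : nat.
Implicit Types (x y : state N) (v w : 'I_N).

Lemma sum_change (F : nat -> nat) x y w : (forall v, v != w -> y v = x v) ->
  (\sum_v F (y v) + F (x w) = \sum_v F (x v) + F (y w))%N.
Proof.
move=> h; rewrite (bigD1 w)//= [in RHS](bigD1 w)//=.
by rewrite (eq_bigr (fun v => F (x v))) => [|v /h -> //]; lia.
Qed.

Lemma cnt_le_size i x : (cnt i x <= N)%N.
Proof.
rewrite -[X in (_ <= X)%N](card_ord N) -sum1_card; apply: leq_sum => v _.
exact: leq_b1.
Qed.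

Lemma cnt_incr i x w : cnt i (incr x w) = (cnt i x + (i == (x w).+1))%N.
Proof.
have := @sum_change (fun k => i <= k : nat)%N x (incr x w) w.
rewrite -/(cnt i x) -/(cnt i (incr x w)) {3}/incr ffunE eqxx => H.
have {}H := H (fun v vw => ltac:(by rewrite ffunE (negbTE vw))).
by lia.
Qed.

Lemma cnt_depart i x w : (0 < i)%N -> (cnt i (depart x w) + (x w == i) = cnt i x)%N.
Proof.
have := @sum_change (fun k => i <= k : nat)%N x (depart x w) w.
rewrite -/(cnt i x) -/(cnt i (depart x w)) {3}/depart ffunE eqxx => H.
have {}H := H (fun v vw => ltac:(by rewrite ffunE (negbTE vw))).
by lia.
Qed.

Lemma cnt_anti i x : (cnt i.+1 x <= cnt i x)%N.
Proof. by apply: leq_sum => v _; case: (ltnP i (x v)) => //= /ltnW ->. Qed.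

Lemma cnt_lt i x : (cnt i x < N)%N -> exists v, (x v < i)%N.
Proof.
move=> h; have [/existsP//|] := boolP [exists v, (x v < i)%N].
rewrite negb_exists => /forallP H; move: h; rewrite /cnt (eq_bigr (fun=> 1%N)).
  by rewrite sum1_card card_ord ltnn.
by move=> v _; rewrite leqNgt H.
Qed.

Lemma cnt_eq0 i x : cnt i x = 0%N -> forall v, (x v < i)%N.
Proof.
move=> /eqP; rewrite /cnt sum_nat_eq0 => /forallP h v.
by have := h v; rewrite ltnNge; case: (_ <= _)%N.
Qed.

Lemma cnt_eq1 x : (cnt 1 x = \sum_v (x v == 1%N) + cnt 2 x)%N.
Proof.
by rewrite /cnt -big_split; apply: eq_bigr => v _ /=; case: (x v) => [|[|]].
Qed.

Variables (R : realType) (G : rel 'I_N) (b : option nat).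
Hypothesis b0 : fits b 1.

Lemma cnt_arrive_ge i x v (u : R) : 0 <= u < 1 -> (cnt i x <= cnt i (arrive G b x v u))%N.
Proof.
by move=> /(arriveP G b x v)[w _ ->]; case: ifP => // _; rewrite cnt_incr leq_addr.
Qed.

Lemma cnt_arrive_le i x v (u : R) : 0 <= u < 1 -> (cnt i (arrive G b x v u) <= (cnt i x).+1)%N.
Proof.
move=> /(arriveP G b x v)[w _ ->]; case: ifP => // _; rewrite cnt_incr.
by case: eqP => _ /=; lia.
Qed.

Lemma cnt1_arrive x v (u : R) : 0 <= u < 1 ->
  cnt 1 (arrive G b x v u) = (cnt 1 x + [exists w, nbhd G v w && (x w == 0%N)])%N.
Proof.
move=> /(arriveP G b x v)[w [nw hw] ->].
have [/existsP[w' /andP[nw' /eqP xw']]|] :=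
  boolP [exists w, nbhd G v w && (x w == 0%N)].
  have xw : x w = 0%N by apply/eqP; rewrite -leqn0 -xw' hw.
  by rewrite xw b0 cnt_incr xw.
rewrite negb_exists => /forallP /(_ w); rewrite nw /= => xw.
by case: ifP => _; rewrite ?cnt_incr; case: (x w) xw => //= m _; rewrite addn0.
Qed.

End Count.

Section MarkDrift.
Variables (R : realType) (n : nat) (b : option nat).
Local Notation N := n.+1.

Lemma mark_u (j : 'I_(((n.+1)`!).-1).+1) : 0 <= (j%:R / ((n.+1)`!)%:R : R) < 1.
Proof.
rewrite divr_ge0//= ltr_pdivrMr ?ltr0n ?fact_gt0// mul1r ltr_nat.
by apply: leq_trans (ltn_ord j) _; rewrite prednK ?fact_gt0.
Qed.

(** At [lam = 1/2] an event is an arrival with probability 1/3 and a potential departure with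
    probability 2/3. The arrival bound is uniform in the tie-breaking variable, whose coordinate
    then sums out. *)
Lemma kop_le_marks (G : rel 'I_N) (V : state N -> R) (f : 'I_N -> bool -> R) x :
  (forall v (u : R), 0 <= u < 1 -> V (arrive G b x v u) <= f v true) ->
  (forall v, V (depart x v) <= f v false) ->
  kop (@mark_weight R n 2^-1) (@dstep R n G b) V x <=
  N%:R^-1 * \sum_v (1 / 3 * f v true + 2 / 3 * f v false).
Proof.
move=> hA hD.
have l0 : 0 < 2^-1 :> R by rewrite invr_gt0.
have <- : \sum_(y : mark_type n) mark_weight 2^-1 y * f y.1.1 y.1.2 =
   N%:R^-1 * \sum_v (1 / 3 * f v true + 2 / 3 * f v false).
  rewrite sum_mark_weight; congr (_ * _); apply: eq_bigr => v _.
  by congr (_ * _ + _ * _); field.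
apply: ler_sum => y _; apply: ler_wpM2l; first exact: mark_weight_ge0.
by rewrite /dstep; case: ifP => h; [apply: hA; exact: mark_u|exact: hD].
Qed.

End MarkDrift.

Section CliqueDrift.
Variables (R : realType) (n : nat) (b : option nat).
Hypothesis b0 : fits b 1.
Local Notation N := n.+1.
Implicit Types (x : state N).

(* Once all servers are busy the value is frozen at its maximum, since the drift
   bound below fails when some server has two tasks. *)
Definition lyap (x : state N) : R :=
  if cnt 2 x == 0%N then ((cnt 1 x)%:R - N%:R / 2) ^+ 2 else (N%:R / 2) ^+ 2.

Lemma lyap_le x : lyap x <= (N%:R / 2) ^+ 2.
Proof.
rewrite /lyap; case: ifP => // _.
have h : (cnt 1 x)%:R <= N%:R :> R by rewrite ler_nat cnt_le_size.
have h0 : 0 <= (cnt 1 x)%:R :> R by [].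
move: h h0; move: (cnt 1 x)%:R (N%:R) => c m h h0; nra.
Qed.

Lemma lyap_ge0 x : 0 <= lyap x.
Proof. by rewrite /lyap; case: ifP => _; rewrite sqr_ge0. Qed.

Lemma clique_arrive_cnt2 x v (u : R) : 0 <= u < 1 -> cnt 2 x = 0%N -> (cnt 1 x < N)%N ->
  cnt 2 (arrive (@clique N) b x v u) = 0%N.
Proof.
move=> /(arriveP (@clique N) b x v)[w [nw hw] ->] c2 /cnt_lt[w' xw'].
have xw : x w = 0%N.
  apply/eqP; rewrite -leqn0; apply: leq_trans (hw w' _) _; last by rewrite -ltnS.
  by rewrite /nbhd /clique eq_sym; case: eqP.
by case: ifP => // _; rewrite cnt_incr c2 xw.
Qed.

Lemma lyap_clique_arrive x v (u : R) : 0 <= u < 1 -> cnt 2 x = 0%N ->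
  lyap (arrive (@clique N) b x v u) =
  if (cnt 1 x < N)%N then ((cnt 1 x).+1%:R - N%:R / 2) ^+ 2 else (N%:R / 2) ^+ 2.
Proof.
move=> hu c2; case: ifP => c1.
  rewrite /lyap clique_arrive_cnt2// eqxx cnt1_arrive//.
  have [w xw] := cnt_lt c1.
  have -> : [exists w, nbhd (@clique N) v w && (x w == 0%N)].
    apply/existsP; exists w; rewrite -leqn0 -ltnS xw andbT.
    by rewrite /nbhd /clique eq_sym; case: eqP.
  by rewrite addn1.
(* With all servers busy the task is lost or becomes a second task; both outcomes give the value
   [(N / 2) ^ 2]. *)
have c1N : cnt 1 x = N.
  by apply/eqP; rewrite eqn_leq cnt_le_size leqNgt c1.
rewrite /lyap; case: ifP => // /eqP _.
have -> : cnt 1 (arrive (@clique N) b x v u) = N.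
  by apply/eqP; rewrite eqn_leq cnt_le_size -{1}c1N cnt_arrive_ge.
by field.
Qed.

Lemma lyap_depart x v : cnt 2 x = 0%N ->
  lyap (depart x v) = if (1 <= x v)%N then ((cnt 1 x)%:R - 1 - N%:R / 2) ^+ 2
                      else ((cnt 1 x)%:R - N%:R / 2) ^+ 2.
Proof.
move=> c2; rewrite /lyap.
have := cnt_depart x v (isT : 0 < 2)%N; rewrite c2 => /eqP; rewrite addn_eq0 => /andP[-> _].
have := cnt_eq0 c2 v.
have := cnt_depart x v (isT : 0 < 1)%N; case: (x v) => [|[|//]] /= <- _.
  by rewrite addn0.
by rewrite natrD addrK.
Qed.

Local Notation kop := (kop (@mark_weight R n 2^-1) (@dstep R n (@clique N) b)).

(** Put [y = cnt 1 x - N/2]. With no second task and an idle server left, the terms of order [y]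
    cancel up to a restoring one, and the drift is [2/3 + (2/3) (y - 2 y^2) / N], at most 1 because
    [y <= N/2]. *)
Lemma lyap_drift x : kop lyap x <= lyap x + 1.
Proof.
have N0 : 0 < N%:R :> R by rewrite ltr0n.
have [c2|c2] := eqVneq (cnt 2 x) 0%N; last first.
  have -> : lyap x = (N%:R / 2) ^+ 2 by rewrite /lyap (negbTE c2).
  apply: (@le_trans _ _ ((N%:R / 2) ^+ 2)); last by rewrite lerDl.
  rewrite -[leRHS](@kopC _ _ _ (@mark_weight R n 2^-1) (@dstep R n (@clique N) b) _ _ x).
    by apply: kop_le; [exact: mark_weight_ge0|exact: lyap_le].
  by apply: mark_weight_sum.
pose A : R := if (cnt 1 x < N)%N then ((cnt 1 x).+1%:R - N%:R / 2) ^+ 2 else (N%:R / 2) ^+ 2.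
apply: (le_trans (@kop_le_marks _ _ _ _ lyap (fun v bb => if bb then A else lyap (depart x v)) x _ _)).
- by move=> v u hu; rewrite lyap_clique_arrive.
- by [].
set q := (cnt 1 x)%:R : R.
have S : \sum_v lyap (depart x v) = q * (q - 1 - N%:R / 2) ^+ 2 + (N%:R - q) * (q - N%:R / 2) ^+ 2.
  rewrite (eq_bigr (fun v => (1 <= x v)%N%:R * ((q - 1 - N%:R / 2) ^+ 2 - (q - N%:R / 2) ^+ 2)
     + (q - N%:R / 2) ^+ 2)); last first.
    move=> v _; rewrite lyap_depart// -/q; case: (1 <= x v)%N => /=.
      by rewrite mul1r subrK.
    by rewrite mul0r add0r.
  rewrite big_split /= -mulr_suml -natr_sum -/(cnt 1 x) -/q sumr_const card_ord.
  by rewrite -mulr_natl; ring.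
rewrite big_split /= -!mulr_sumr S sumr_const card_ord -[X in 1 / 3 * X]mulr_natl.
have -> : lyap x = (q - N%:R / 2) ^+ 2 by rewrite /lyap c2 eqxx.
rewrite ler_pdivrMl//.
have q0 : 0 <= q by [].
rewrite /A; case: ltnP => c1.
  have qN : q <= N%:R by rewrite ler_nat ltnW.
  rewrite -[(cnt 1 x).+1%:R]natr1 -/q; have := sqr_ge0 (q - N%:R / 2).
  move: qN N0 q0; clear; move: q (N%:R) => q m; nra.
have -> : q = N%:R by congr (_%:R); apply/eqP; rewrite eqn_leq cnt_le_size c1.
have : 1 <= N%:R :> R by rewrite ler1n.
move: N0; clear; move: (N%:R) => m N0 N1; nra.
Qed.

End CliqueDrift.

(** * The drift on a graph with many low-degree vertices *)

Lemma degreeE (N : nat) (G : rel 'I_N) v : degree G v = (\sum_w G v w)%N.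
Proof.
rewrite /degree -sum1_card big_mkcond; apply: eq_bigr => w _.
rewrite (_ : (w \in _) = G v w); first by case: (G v w).
by apply/idP/idP => [/set_mem//|h]; exact/mem_set.
Qed.

Lemma nbhd_le (N : nat) (G : rel 'I_N) v : (\sum_w nbhd G v w <= (degree G v).+1)%N.
Proof.
rewrite degreeE -addn1 addnC.
have <- : (\sum_w (w == v) = 1)%N.
  rewrite (bigD1 v)//= eqxx big1 ?addn0// => w /negbTE ->//.
rewrite -big_split; apply: leq_sum => w _ /=; rewrite /nbhd.
by case: eqP => //= _; case: (G v w).
Qed.

Section Deficit.
Variables (R : realType) (n : nat) (G : rel 'I_n.+1) (b : option nat).
Hypothesis b0 : fits b 1.
Variables (S : pred 'I_n.+1) (M : nat).
Hypothesis S_degree : forall v, S v -> (degree G v <= M)%N.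
Local Notation N := n.+1.
Implicit Types (x : state N).

Local Notation kop := (kop (@mark_weight R n 2^-1) (@dstep R n G b)).
Local Notation kiter := (kiter (@mark_weight R n 2^-1) (@dstep R n G b)).

(* Bounds the number of servers of [S] at which an arrival increases [cnt 1]. *)
Definition emp x : nat := (\sum_(v | S v) \sum_(w | nbhd G v w) (x w == 0%N))%N.

Let c1 x : R := (cnt 1 x)%:R.
Let c2 x : R := (cnt 2 x)%:R.
Let e x : R := (emp x)%:R.
Let s : R := (\sum_(v | S v) 1)%N%:R.

Let N0 : 0 < N%:R :> R. Proof. by rewrite ltr0n. Qed.
Let w0 y : 0 <= @mark_weight R n 2^-1 y.
Proof. by apply: mark_weight_ge0; rewrite invr_gt0. Qed.
Let w1 : \sum_y @mark_weight R n 2^-1 y = 1.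
Proof. by apply: mark_weight_sum. Qed.

Lemma cnt_dstep_le i x y : (0 < i)%N -> (cnt i (@dstep R n G b x y) <= (cnt i x).+1)%N.
Proof.
move=> i0; rewrite /dstep; case: ifP => _.
  by apply: cnt_arrive_le => //; exact: mark_u.
by have := cnt_depart x y.1.1 i0; lia.
Qed.

Lemma cnt_dstep_ge i x y : (0 < i)%N -> (cnt i x <= (cnt i (@dstep R n G b x y)).+1)%N.
Proof.
move=> i0; rewrite /dstep; case: ifP => _.
  by apply: leqW; apply: cnt_arrive_ge => //; exact: mark_u.
by have := cnt_depart x y.1.1 i0; case: (_ == _) => /=; lia.
Qed.

Lemma kiter_c1_ge k x : c1 x - k%:R <= kiter k c1 x.
Proof.
(* [kiter_drift] bounds from above only, so the lower bound is obtained for the opposite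
   function. *)
have h z : kop (fun z => -1 * c1 z) z <= -1 * c1 z + 1.
  rewrite -[leRHS](kopC (@dstep R n G b) w1 _ z).
  apply: ler_sum => y _; apply: ler_wpM2l => //.
  have h : c1 z <= c1 (@dstep R n G b z y) + 1 by rewrite /c1 natr1 ler_nat cnt_dstep_ge.
  by rewrite !mulN1r; lra.
have := @kiter_drift _ _ _ _ _ w0 w1 k _ _ x h.
rewrite kiterZ mulr1; move: (c1 x) (kiter k c1 x) (k%:R) => u v j; lra.
Qed.

Lemma kiter_c2_le k x : kiter k c2 x <= c2 x + k%:R.
Proof.
have h z : kop c2 z <= c2 z + 1.
  rewrite -[leRHS](kopC (@dstep R n G b) w1 _ z).
  apply: ler_sum => y _; apply: ler_wpM2l => //.
  by rewrite /c2 natr1 ler_nat cnt_dstep_le.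
by have := @kiter_drift _ _ _ _ _ w0 w1 k _ _ x h; rewrite mulr1.
Qed.

Lemma emp_arrive x v (u : R) : 0 <= u < 1 -> (emp (arrive G b x v u) <= emp x)%N.
Proof.
move=> /(arriveP G b x v)[w _ ->]; case: ifP => // _.
apply: leq_sum => v' _; apply: leq_sum => w' _; rewrite ffunE.
by case: ifP => //; case: (x w').
Qed.

Lemma emp_depart x u : (emp (depart x u) <= emp x + \sum_(v | S v) nbhd G v u)%N.
Proof.
rewrite /emp -big_split; apply: leq_sum => v Sv /=.
have -> : (nbhd G v u = \sum_(w | nbhd G v w) (w == u) :> nat)%N.
  case: (boolP (nbhd G v u)) => nu.
    by rewrite (bigD1 u)//= eqxx big1 // => w /andP[_ /negbTE ->].
  by rewrite big1// => w nw; case: eqP => // wu; rewrite -wu nw in nu.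
rewrite -big_split; apply: leq_sum => w _ /=; rewrite ffunE.
by case: (w == u); case: (x w) => [|[|m']].
Qed.

(** Arrivals create no idle server. A departure from [u] adds at most one for each [v] in [S] whose
    neighborhood contains [u]; counting such pairs by [v] gives at most [s * M.+1] over the [N]
    choices of [u]. *)
Lemma kop_emp x : kop e x <= e x + 2 / 3 * (s * M.+1%:R / N%:R).
Proof.
apply: (le_trans (@kop_le_marks _ _ _ G e
  (fun v bb => if bb then e x else e x + (\sum_(u | S u) nbhd G u v)%N%:R) x _ _)).
- by move=> v u hu; rewrite ler_nat emp_arrive.
- by move=> v; rewrite -natrD ler_nat emp_depart.
rewrite big_split /= -!mulr_sumr sumr_const card_ord -[X in 1 / 3 * X]mulr_natl.
rewrite big_split /= sumr_const card_ord -[X in 2 / 3 * (X + _)]mulr_natl.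
set t := \sum_(v < N) _.
have ht : t <= s * M.+1%:R.
  rewrite /t -natr_sum /s -natrM ler_nat exchange_big /= big_distrl /=.
  apply: leq_sum => v Sv; rewrite mul1n; apply: leq_trans (nbhd_le G v) _.
  by rewrite ltnS S_degree.
rewrite ler_pdivrMl//.
have -> : N%:R * (e x + 2 / 3 * (s * M.+1%:R / N%:R)) = N%:R * e x + 2 / 3 * (s * M.+1%:R).
  by rewrite mulrDr; congr (_ + _); rewrite mulrCA [_ / N%:R]mulrC mulVKf// gt_eqF.
move: ht; move: (N%:R) (e x) (s * _) t => m ex sm t' ht; lra.
Qed.

(** An arrival at [v] in [S] raises [cnt 1] only through an idle server near [v], which [emp]
    counts; arrivals elsewhere are bounded by 1. A departure lowers [cnt 1] exactly at servers with
    one task, and there are [c1 - c2] of them. *)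
Lemma kop_c1 x : kop c1 x <=
  c1 x + 1 / 3 * (1 - s / N%:R + e x / N%:R) - 2 / 3 * ((c1 x - c2 x) / N%:R).
Proof.
pose g v : nat := if S v then (\sum_(w | nbhd G v w) (x w == 0%N))%N else 1%N.
apply: (le_trans (@kop_le_marks _ _ _ G c1
  (fun v bb => if bb then c1 x + (g v)%:R else c1 x - (x v == 1%N)%:R) x _ _)).
- move=> v u hu; rewrite /c1 -natrD ler_nat cnt1_arrive// leq_add2l /g.
  case: (S v); last exact: leq_b1.
  case: (boolP [exists w, _]) => // /existsP[w /andP[nw xw]].
  by rewrite (bigD1 w)//= xw.
- by move=> v; rewrite lerBrDr -natrD cnt_depart.
rewrite big_split /= -!mulr_sumr big_split /= sumr_const card_ord.
rewrite big_split /= sumr_const card_ord sumrN -!natr_sum.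
have hg : ((\sum_v g v + \sum_(v | S v) 1 = emp x + N)%N).
  rewrite -[X in (_ = _ + X)%N](card_ord N) -sum1_card /emp.
  rewrite [X in (_ + X)%N]big_mkcond [X in (_ = X + _)%N]big_mkcond -!big_split /=.
  by apply: eq_bigr => v _; rewrite /g; case: (S v); rewrite ?addn0.
have {}hg : (\sum_v g v)%N%:R = e x + N%:R - s.
  by rewrite /e /s -natrD -hg natrD addrK.
have hc : (\sum_v (x v == 1%N))%N%:R = c1 x - c2 x.
  by rewrite /c1 (cnt_eq1 x) natrD addrK.
rewrite hg hc ler_pdivrMl// -[c1 x *+ N]mulr_natl.
have mn : N%:R != 0 :> R by rewrite gt_eqF.
move: mn; move: (N%:R : R) => m mn.
rewrite le_eqVlt; apply/orP; left; apply/eqP.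
by field.
Qed.

(** After [j] events, on average, [c1] has lost at most [j], [c2] has gained at most [j] and [e] at
    most [j / 3]. The next drift is therefore at most [(1 - s) / (3 N) + (13/9) j / N], where
    [1 / (3 N)] is the parity defect of [N - 1 <= 2 * c1]. Summing over [j < k] stays below the
    stated quadratic term. *)
Lemma deficit x0 k : cnt 2 x0 = 0%N -> emp x0 = 0%N -> N%:R - 1 <= 2 * c1 x0 ->
  2 * (s * M.+1%:R) <= N%:R ->
  kiter k c1 x0 <=
  c1 x0 - k%:R * s / (3 * N%:R) + k%:R / (3 * N%:R) + 3 / 2 * k%:R ^+ 2 / N%:R.
Proof.
move=> hc2 he hc1 hs; elim: k => [|k IH].
  by rewrite expr0n /= !mul0r mulr0 mul0r subr0 !addr0.
have He : kiter k e x0 <= k%:R * (2 / 3 * (s * M.+1%:R / N%:R)).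
  have := @kiter_drift _ _ _ _ _ w0 w1 k e _ x0 kop_emp.
  by rewrite /e he add0r.
have Hc2 := kiter_c2_le k x0; rewrite {2}/c2 hc2 add0r in Hc2.
have Hc1 := kiter_c1_ge k x0.
pose g z := c1 z + 1 / 3 * (1 - s / N%:R + e z / N%:R) - 2 / 3 * ((c1 z - c2 z) / N%:R).
rewrite kiterS; apply: (le_trans (@kiter_le _ _ _ _ _ w0 k _ g kop_c1 x0)).
set K := kiter k.
have -> : K g x0 =
   K c1 x0 + (1 / 3 * (1 - s / N%:R) + (1 / 3 / N%:R * K e x0 +
     (- (2 / 3 / N%:R) * K c1 x0 + 2 / 3 / N%:R * K c2 x0))).
  rewrite /K -!kiterZ -!kiterD -[X in X + (_ x0)](kiterC (@dstep R n G b) w1 k _ x0).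
  rewrite -!kiterD; apply: eq_kiter => z; rewrite /g; ring.
move: IH He Hc2 Hc1 hc1 hs N0; rewrite -/K -[k.+1%:R]natr1.
have k0 : 0 <= k%:R :> R by [].
have s0 : 0 <= s * M.+1%:R by rewrite /s -natrM.
move: (s * M.+1%:R) s0 => sM s0.
move: (K c1 x0) (K e x0) (K c2 x0) (c1 x0) s k%:R k0 (N%:R) => a1 ae a2 c t j j0 m.
move=> IH He H2 H1 hc hs m0.
have i0 : 0 <= m^-1 by rewrite invr_ge0 ltW.
have mi : m * m^-1 = 1 by rewrite mulfV// gt_eqF.
have sMi : 2 * (sM * m^-1) <= 1 by rewrite mulrA -[leRHS]mi; apply: ler_wpM2r.
have hae : ae <= j * (1 / 3).
  apply: le_trans He _; apply: ler_wpM2l => //; lra.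
have haei := ler_wpM2r i0 hae; have ha1 := ler_wpM2r i0 H1; have ha2 := ler_wpM2r i0 H2.
have hci := ler_wpM2r i0 hc; have ji := mulr_ge0 j0 i0.
rewrite !invfM expr2 in IH *; rewrite mulrBl mi in hci.
move: (m^-1) i0 mi sMi haei ha1 ha2 hci ji IH {He hs hc hae H1 H2 m0} => i i0 mi sMi haei ha1 ha2 hci ji IH.
nra.
Qed.

End Deficit.

(** * Event times *)

Section Time.
Context {R : realType} {d : measure_display} {T : measurableType d}.
Variables (P : probability T R) (U : nat -> T -> R).
Hypothesis hU : iid_uniform P U.
Hypothesis U_itv : forall k w, 0 < U k w < 1.

Lemma NlnU_gt0 k w : 0 < - ln (U k w).
Proof. by rewrite oppr_gt0 ln_lt0. Qed.

Lemma NlnU_ge k w : 1 - U k w <= - ln (U k w).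
Proof.
have /andP[u0 _] := U_itv k w.
have := expR_ge1Dx (ln (U k w)); rewrite lnK ?posrE//; lra.
Qed.

Section EventTime.
Variables (N : nat) (lam : R).
Hypotheses (N0 : (0 < N)%N) (lam0 : 0 < lam).

Let rate_gt0 : 0 < N%:R * (lam + 1).
Proof. by rewrite mulr_gt0 ?ltr0n// addr_gt0. Qed.

Lemma event_time_ltS n w : event_time N lam U n w < event_time N lam U n.+1 w.
Proof.
rewrite /event_time big_ord_recr /= ltrDl divr_gt0//; exact: NlnU_gt0.
Qed.

Lemma event_time_lt n m w : (event_time N lam U n w < event_time N lam U m w) = (n < m)%N.
Proof.
have H : {homo (fun n => event_time N lam U n w) : i j / (i < j)%N >-> i < j}.
  by apply: homo_ltn => [y x z|i]; [exact: lt_trans|exact: event_time_ltS].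
by apply: (leW_mono (le_mono H)).
Qed.

Lemma nevents_eq n t w : event_time N lam U n w <= t < event_time N lam U n.+1 w ->
  nevents N lam U t w = n.
Proof.
move=> /andP[h1 h2]; apply: xget_unique; first by rewrite /= h1.
move=> m /andP[h3 h4]; apply/eqP; rewrite eqn_leq -ltnS -(event_time_lt _ _ w).
by rewrite (le_lt_trans h3)//= -ltnS -(event_time_lt _ _ w) (le_lt_trans h1).
Qed.

Lemma nevents_lt m t w : (0 < m)%N -> t < event_time N lam U m w ->
  (nevents N lam U t w < m)%N.
Proof.
move=> m0 tm; rewrite /nevents.
set A := [set n | _].
have [[n An]|noA] := pselect (exists n, A n).
  have /andP[h _] : A (xget 0%N A) by apply: xgetPex; exists n.
  by rewrite -(event_time_lt _ _ w); apply: le_lt_trans tm.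
(* When no number of events fits, [nevents] takes the default value 0, which is below [m] since [m]
   is positive. *)
rewrite (_ : xget 0%N A = 0%N)//; case: xgetP => // x _ Ax.
by exfalso; apply: noA; exists x.
Qed.

End EventTime.

(** A finite bound on the mean is enough, and a geometric series gives one. If [K] is the integer
    part of [- ln u], then [u <= expR (- i) <= 2^-1 ^+ i] for [i <= K], so [- ln u < K + 1] is at
    most the number of levels [2^-1 ^+ i] not below [u]. *)
Lemma integral_NlnU_le k : (\int[P]_w (- ln (U k w))%:E <= 2%:E)%E.
Proof.
pose g (i : nat) (w : T) : \bar R := (\1_[set w | U k w <= 2^-1 ^+ i] w)%:E.
have mg i : measurable_fun setT (g i).
  apply/measurable_EFinP; apply: measurable_indic.
  exact: (measurable_U_le hU).
apply: (@le_trans _ _ (\int[P]_w (\sum_(0 <= i <oo) g i w))%E).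
  apply: ge0_le_integral => //.
  - by move=> w _; rewrite lee_fin ltW// NlnU_gt0.
  - apply/measurable_EFinP; apply: measurableT_comp => //.
    by apply: measurableT_comp; [exact: measurable_ln|exact: hU.1].
  - by apply: ge0_emeasurable_sum => // i w _ _; rewrite /g lee_fin.
  move=> w _; have /andP[u0 u1] := U_itv k w.
  have L0 := ltW (NlnU_gt0 k w).
  have /andP[h1 h2] := truncn_itv L0; set K := Num.truncn _ in h1 h2.
  apply: le_trans (@nneseries_lim_ge R (g^~ w) xpredT 0 K.+1 _); last first.
    by move=> i _ _; rewrite /g lee_fin.
  rewrite (eq_big_nat _ _ (F2 := fun=> 1%E)); last first.
    move=> i /andP[_ iK]; rewrite /g indicE mem_set//=.
    rewrite -[leLHS]lnK ?posrE// -[ln _]opprK.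
    apply: (@le_trans _ _ (expR (- i%:R))).
      rewrite ler_expR lerN2; apply: le_trans h1; rewrite ler_nat -ltnS//.
    rewrite -mulrN1 expRM_natl; apply: lerXn2r; rewrite ?nnegrE ?expR_ge0 ?invr_ge0//.
    rewrite expRN lef_pV2 ?posrE ?expR_gt0//.
    by have := expR_ge1Dx (1 : R); lra.
  rewrite sumEFin lee_fin big_mkord sumr_const card_ord.
  exact: ltW.
rewrite integral_nneseries//.
rewrite (eq_eseriesr (g := fun i => (2 / (2 ^ i.+1)%:R)%:E)); last first.
  move=> i _; rewrite integral_indic//; last exact: (measurable_U_le hU).
  rewrite setIT; transitivity (pr P [set w | U k w <= 2^-1 ^+ i])%:E.
    by apply: prE; exact: (measurable_U_le hU).
  have [_ /(_ [:: k] (fun=> 2^-1 ^+ i) isT)] := indep_le hU.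
  rewrite !big_seq1 => ->; rewrite clamp01_id.
    by congr (_%:E); rewrite natrX exprS invfM mulrA mulfV// mul1r exprVn.
  by rewrite exprn_ge0//= exprn_ile1// ?invr_ge0// invf_le1// ler1n.
exact: epsilon_trick0.
by move=> i w _; rewrite /g lee_fin.
Qed.

Lemma measurable_NlnU_sum n : measurable_fun setT (fun w => \sum_(k < n) - ln (U (4 * k)%N w)).
Proof.
apply: measurable_sum => k; apply: measurableT_comp => //.
by apply: measurableT_comp; [exact: measurable_ln|exact: hU.1].
Qed.

Lemma measurable_event_sum n (s : R) :
  measurable [set w | s < \sum_(k < n) - ln (U (4 * k)%N w)].
Proof.
rewrite (_ : [set w | _] = setT `&` (fun w => \sum_(k < n) - ln (U (4 * k)%N w)) @^-1` `]s, +oo[).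
  exact: measurable_NlnU_sum.
by apply/seteqP; split => w; rewrite /= in_itv /= andbT; [|case].
Qed.

Lemma event_time_upper (n : nat) (s : R) : 0 < s ->
  pr P [set w | s < \sum_(k < n) - ln (U (4 * k)%N w)] <= n%:R * 2 / s.
Proof.
move=> s0; set E := [set w | _].
have mL k : measurable_fun setT (fun w => - ln (U k w)).
  apply: measurableT_comp => //.
  by apply: measurableT_comp; [exact: measurable_ln|exact: hU.1].
have mS := measurable_NlnU_sum n.
have mE : measurable E := measurable_event_sum n s.
rewrite ler_pdivlMr// mulrC -lee_fin EFinM -prE// -integral_cst//.
apply: (@le_trans _ _ (\int[P]_(w in E) (\sum_(k < n) - ln (U (4 * k)%N w))%:E)%E).
  apply: ge0_le_integral => //.
  - by move=> w _; rewrite lee_fin ltW.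
  - by apply/measurable_EFinP; apply: measurable_funTS.
  - by move=> w /ltW; rewrite lee_fin.
apply: (@le_trans _ _ (\int[P]_w (\sum_(k < n) - ln (U (4 * k)%N w))%:E)%E).
  apply: ge0_subset_integral => //; first exact/measurable_EFinP.
  by move=> w _; rewrite lee_fin sumr_ge0// => k _; exact/ltW/NlnU_gt0.
under eq_integral do rewrite -sumEFin.
rewrite ge0_integral_sum//; last 2 first.
- by move=> k; exact/measurable_EFinP.
- by move=> k w _; rewrite lee_fin; exact/ltW/NlnU_gt0.
apply: (@le_trans _ _ (\sum_(k < n) 2%:E)%E).
  by apply: lee_sum => k _; exact: integral_NlnU_le.
by rewrite sumEFin sumr_const card_ord mulr_natl.
Qed.

Definition half_count (m : nat) (w : T) : nat := \sum_(k < m) half_mark U k w.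

Lemma half_count_ge m w : (half_count m w)%:R / 2 <= \sum_(k < m) - ln (U (4 * k)%N w).
Proof.
rewrite /half_count natr_sum mulr_suml; apply: ler_sum => k _.
rewrite /half_mark; have [h|h] := leP (U (4 * k)%N w) 2^-1 => /=.
  by apply: (le_trans _ (NlnU_ge _ _)); move: h; lra.
by rewrite mul0r ltW// NlnU_gt0.
Qed.

(** Chebyshev's inequality, obtained from the chain machinery: the square [V] of the centered walk
    has drift exactly 1, and the event forces [V >= m^2 / 4]. The state also carries the number of
    steps, which makes [V] a function of the state. *)
Lemma half_count_small (m : nat) : (0 < m)%N ->
  measurable [set w | 4 * (half_count m w)%:R <= m%:R :> R] /\
  pr P [set w | 4 * (half_count m w)%:R <= m%:R :> R] <= 4 / m%:R.
Proof.
move=> m0.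
have alg (x y : R) : 0 < x -> 4 * y <= x -> 0 <= y -> x ^+ 2 / 4 <= (2 * y - x) ^+ 2.
  by move=> x0 h y0; nra.
pose phi (z : nat * nat) (c : bool) := (z.1 + c, z.2.+1)%N.
have zE k w : zproc phi (half_mark U) (0, 0)%N k w = (half_count k w, k).
  elim: k => [|k IH] /=; first by rewrite /half_count big_ord0.
  by rewrite IH /phi /= /half_count big_ord_recr.
have s1 : \sum_(c : bool) (fun=> 2^-1 : R) c = 1 by rewrite big_bool /=; lra.
have w0 (c : bool) : 0 <= (2^-1 : R) by rewrite invr_ge0.
pose V (z : nat * nat) : R := (2 * z.1%:R - z.2%:R) ^+ 2.
pose X (z : nat * nat) : bool := (4 * z.1%:R <= z.2%:R :> R) && (z.2 == m).
have iH := indep_half hU.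
have -> : [set w | 4 * (half_count m w)%:R <= m%:R :> R] =
    [set w | X (zproc phi (half_mark U) (0, 0)%N m w)].
  by apply/seteqP; split => w; rewrite /X /= zE /= eqxx andbT.
split; first exact: (@measurable_zproc _ _ _ (fun=> 2^-1) _ _ _ _ _ iH).
have mR : 0 < m%:R :> R by rewrite ltr0n.
apply: le_trans (@pr_zproc_markov _ _ _ _ _ w0 s1 _ _ _ _ iH _ _ X V (m%:R ^+ 2 / 4) _ _ _) _.
- by rewrite divr_gt0// exprn_gt0.
- by move=> z; exact: sqr_ge0.
- move=> [c j] /andP[/= h /eqP jm]; rewrite jm in h; rewrite /V /= jm.
  have c0 : 0 <= c%:R :> R by [].
  exact: alg.
rewrite ler_pdivrMr ?divr_gt0 ?exprn_gt0//.
rewrite (_ : 4 / m%:R * (m%:R ^+ 2 / 4) = m%:R); last by field; rewrite gt_eqF.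
have dr z : kop (fun=> 2^-1) phi V z <= V z + 1.
  rewrite /kop big_bool /V /phi /= addn0 addn1 -![_.+1%:R]natr1.
  rewrite le_eqVlt; apply/orP; left; apply/eqP; by field.
have := @kiter_drift _ _ _ _ _ w0 s1 m _ _ (0,0)%N dr.
by rewrite mulr1 {2}/V /= mulr0 subr0 expr0n /= add0r.
Qed.

End Time.

(** * The fluid limit on the clique *)

Definition indic_state (N : nat) (A : pred 'I_N) : state N := [ffun v => A v : nat].

Lemma cnt1_indic (N : nat) (A : pred 'I_N) : cnt 1 (indic_state A) = (\sum_(v | A v) 1)%N.
Proof.
rewrite /cnt [RHS]big_mkcond; apply: eq_bigr => v _; rewrite ffunE.
by case: (A v).
Qed.

Lemma cnt2_indic (N : nat) (A : pred 'I_N) i : cnt i.+2 (indic_state A) = 0%N.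
Proof. by rewrite /cnt big1// => v _; rewrite ffunE; case: (A v). Qed.

Lemma cnt0 (N : nat) (x : state N) : cnt 0 x = N.
Proof. by rewrite /cnt (eq_bigr (fun=> 1%N))// sum1_card card_ord. Qed.

Lemma sum_ltn_half (N : nat) : (\sum_(v < N | v < N./2) 1 = N./2)%N.
Proof.
have hN : (N./2 <= N)%N by rewrite -divn2 leq_div.
by rewrite (big_ord_narrow (F := fun=> 1%N) hN) sum1_card card_ord.
Qed.

Lemma cnt_ge2_eq0 (N i : nat) (x : state N) : cnt 2 x = 0%N -> cnt i.+2 x = 0%N.
Proof.
move=> c2; elim: i => // i IH; apply/eqP; rewrite -leqn0 -[leqRHS]IH.
exact: cnt_anti.
Qed.

(* The fixed point of the Join-the-Shortest-Queue fluid limit at arrival rate 1/2. *)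
Definition fluid (R : realType) (i : nat) : R :=
  if i is i'.+1 then (if i' is 0 then 2^-1 else 0) else 1.

(** * Paths on the clique between grid times *)

Section Path.
Variables (R : realType) (n : nat) (b : option nat).
Hypothesis b0 : fits b 1.
Local Notation N := n.+1.
Variable x : nat -> state N.
Hypothesis x_step : forall k, exists y, x k.+1 = @dstep R n (@clique N) b (x k) y.
Variables (eps : R) (h Gc : nat).
Hypotheses (eps0 : 0 < eps) (eps4 : eps <= 1 / 4) (h0 : (0 < h)%N) (hh : h%:R <= eps * N%:R / 2).
Hypothesis grid : forall g, (g < Gc)%N -> lyap R (x (g * h)) < (eps * N%:R / 2) ^+ 2.

(** Fewer than [h <= eps N / 2] events separate [k] from the preceding grid time, so the deviation
    at most doubles. It stays below [N / 4]; hence an idle server exists and every arrival on the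
    clique joins one. *)
Lemma path_close k : (k < Gc * h)%N ->
  cnt 2 (x k) = 0%N /\ `|(cnt 1 (x k))%:R - N%:R / 2| <= eps * N%:R :> R.
Proof.
have alg (c m e a j : R) : 0 < m -> e <= m / 4 -> 0 < e -> c <= m / 2 + (e / 2 + j) ->
    j + 1 <= a -> a <= e / 2 -> c < m by lra.
move=> kG; rewrite (divn_eq k h).
have gG : (k %/ h < Gc)%N by rewrite ltn_divLR.
have jh : (k %% h < h)%N by rewrite ltn_mod.
move: (k %/ h)%N (k %% h)%N gG jh => g j gG jh.
have N0 : 0 < N%:R :> R by rewrite ltr0n.
have eN : eps * N%:R <= N%:R / 4 by have := ler_wpM2r (ltW N0) eps4; lra.
have eN0 : 0 < eps * N%:R by rewrite mulr_gt0.
suff [-> H] : cnt 2 (x (g * h + j)) = 0%N /\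
    `|(cnt 1 (x (g * h + j)))%:R - N%:R / 2| <= eps * N%:R / 2 + j%:R :> R.
  split => //; apply: le_trans H _.
  have : j%:R <= h%:R :> R by rewrite ler_nat ltnW.
  by move: hh; move: (eps * N%:R) (j%:R) (h%:R) => a u v; lra.
elim: j jh => [_|j IH jh].
  rewrite !addn0; have := grid gG; rewrite /lyap; case: eqP => [-> H|_ H].
    split => //; rewrite ltW//.
    rewrite -(ltr_pXn2r (n := 2)) ?nnegrE ?addr_ge0 ?divr_ge0 ?(ltW eN0)//.
    by rewrite -normrX ger0_norm ?sqr_ge0// addr0.
  by exfalso; move: H; rewrite ltNge => /negP; apply; apply: lerXn2r; rewrite ?nnegrE; lra.
have [c2 c1] := IH (ltnW jh).
have jh' : j.+1%:R <= h%:R :> R by rewrite ler_nat ltnW.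
have c1N : (cnt 1 (x (g * h + j)) < N)%N.
  rewrite -(ltr_nat R); move: c1; rewrite ler_distl => /andP[_ c1].
  rewrite -[j.+1%:R]natr1 in jh'; exact: (alg _ _ _ _ _ N0 eN eN0 c1 jh' hh).
rewrite addnS; have [y ->] := x_step (g * h + j).
split.
  rewrite /dstep; case: ifP => _; first by apply: clique_arrive_cnt2 => //; exact: mark_u.
  by have := cnt_depart (x (g * h + j)) y.1.1 (isT : 0 < 2)%N; rewrite c2; lia.
have H1 := cnt_dstep_ge R (@clique N) b0 (x (g * h + j)) y (isT : 0 < 1)%N.
have H2 := cnt_dstep_le R (@clique N) b0 (x (g * h + j)) y (isT : 0 < 1)%N.
rewrite -(ler_nat R) -[(cnt _ _).+1%:R]natr1 in H1.
rewrite -(ler_nat R) -[(cnt _ _).+1%:R]natr1 in H2.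
rewrite -[j.+1%:R]natr1; move: c1; rewrite !ler_distl => /andP[h3 h4].
by apply/andP; split; lra.
Qed.

End Path.

Section CliqueFluid.
Context {R : realType} {d : measure_display} {T : measurableType d}.
Variables (P : probability T R) (U : nat -> T -> R).
Hypothesis hP : forall A B, A `<=` B -> (P A <= P B)%E.
Hypothesis hU : iid_uniform P U.
Hypothesis U_itv : forall k w, 0 < U k w < 1.
Variable b : option nat.
Hypothesis b0 : fits b 1.

Let lam0 : 0 < 2^-1 :> R. Proof. by rewrite invr_gt0. Qed.

Definition idle_state (N : nat) : state N := indic_state (fun v : 'I_N => (v < N./2)%N).

Lemma lyap_idle (n : nat) : lyap R (idle_state n.+1) <= 1.
Proof.
rewrite /lyap /idle_state cnt2_indic eqxx cnt1_indic sum_ltn_half.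
have -> : n.+1%:R = (odd n.+1)%:R + 2 * (n.+1./2)%:R :> R.
  by rewrite -{1}(odd_double_half n.+1) natrD -mul2n natrM.
by move: (_./2%:R) => y; case: (odd _) => /=; nra.
Qed.

Lemma pr_lyap (n k : nat) (M : R) : 0 < M ->
  measurable [set w | M <= lyap R (chain (@clique n.+1) b 2^-1 U (idle_state n.+1) k w)] /\
  pr P [set w | M <= lyap R (chain (@clique n.+1) b 2^-1 U (idle_state n.+1) k w)] <=
  (1 + k%:R) / M.
Proof.
move=> M0.
have -> : [set w | M <= lyap R (chain (@clique n.+1) b 2^-1 U (idle_state n.+1) k w)] =
   [set w | (fun z => M <= lyap R z) (zproc (@dstep R n (@clique n.+1) b) (mark U n 2^-1)
      (idle_state n.+1) k w)].
  by apply/seteqP; split => w /=; rewrite chain_zproc.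
have iM := indep_mark hU U_itv n lam0.
have w0 := mark_weight_ge0 (n := n) lam0.
have w1 := mark_weight_sum n (2^-1 : R).
split; first exact: (measurable_zproc (wt := @mark_weight R n 2^-1) (@dstep R n (@clique n.+1) b) iM _ _ (fun z => M <= lyap R z)).
apply: (le_trans (@pr_zproc_markov _ _ _ _ (@dstep R n (@clique n.+1) b) w0 w1 _ _ _ _ iM
  (idle_state n.+1) k (fun z => M <= lyap R z) (@lyap R n) M M0 (@lyap_ge0 R n) (fun z h => h))).
rewrite ler_pM2r ?invr_gt0//.
apply: (le_trans (@kiter_drift _ _ _ _ _ w0 w1 k _ _ (idle_state n.+1) (lyap_drift R b0))).
by rewrite mulr1 lerD2r lyap_idle.
Qed.

Lemma clique_fluid : conv_fluid P
  (fun N i t w => qproc (@clique N) b 2^-1 U (idle_state N) i t w) (fun i _ => fluid R i).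
Proof.
move=> i tmax eps0 delta tmax0 eps0_gt0 delta0.
have alg (v c t a : R) : v * (12 * t) < v * c -> v * c < 4 * a ->
    t * (v * (2^-1 + 1)) < a / 2 by lra.
pose eps := Num.min eps0 (1 / 4).
have eps_gt0 : 0 < eps by rewrite /eps lt_min eps0_gt0/=; lra.
have eps4 : eps <= 1 / 4 by rewrite /eps ge_min lexx orbT.
have epsle : eps <= eps0 by rewrite /eps ge_min lexx.
(* More than [m / 4] successful coins make the clock sum at least [m / 8]; dividing by the rate
   [3 N / 2] leaves a time of at least [C / 12]. *)
pose C := (Num.truncn (12 * tmax)).+1.
have hC : 12 * tmax < C%:R by exact: truncnS_gt.
(* Grid steps satisfy [h >= eps N / 4], so this many of them cover all [N * C] events. *)
pose Gc := (Num.truncn (4 * C%:R / eps)).+1.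
have hG : 4 * C%:R / eps < Gc%:R by exact: truncnS_gt.
(* The failure probability is at most [D / N]: the coins cost [4 / N], and each of the [Gc] grid
   times costs at most [2 Gc N / (eps N / 2)^2]. *)
pose D := 4 + Gc%:R * (8 * Gc%:R / eps ^+ 2).
pose N0 := maxn 1 (maxn (Num.truncn (4 / eps)).+1 (Num.truncn (D / delta)).+1).
exists N0 => // -[|n]; first by rewrite /= /N0 leqNgt; case/negP; rewrite leq_max.
rewrite /= !geq_max => /and3P[_ hN1 hN2].
set N := n.+1 in hN1 hN2 *.
have Ngt0 : 0 < N%:R :> R by rewrite ltr0n.
have epsN : 4 <= eps * N%:R.
  rewrite mulrC -ler_pdivrMr//; apply: le_trans (ltW (truncnS_gt _)) _.
  by rewrite ler_nat.
have DN : D / N%:R <= delta.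
  rewrite ler_pdivrMr// mulrC -ler_pdivrMr//; apply: le_trans (ltW (truncnS_gt _)) _.
  by rewrite ler_nat.
pose m := (N * C)%N.
pose h := Num.truncn (eps * N%:R / 2).
have e2 : 0 <= eps * N%:R / 2 by lra.
have /andP[h1 h2] := truncn_itv e2; rewrite -/h in h1 h2.
have h4 : eps * N%:R / 4 <= h%:R by move: h2; rewrite -[h.+1%:R]natr1; move: (h%:R) (eps * N%:R) epsN => u v; lra.
have h0 : (0 < h)%N by rewrite -(ltr_nat R); lra.
have mG : (m <= Gc * h)%N.
  rewrite -(ler_nat R) /m !natrM.
  have cg : 4 * C%:R <= eps * Gc%:R by rewrite [leRHS]mulrC -ler_pdivrMr// ltW.
  have a1 : N%:R * (4 * C%:R) <= N%:R * (eps * Gc%:R) by apply: ler_wpM2l.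
  have a2 : Gc%:R * (eps * N%:R / 4) <= Gc%:R * h%:R by apply: ler_wpM2l.
  move: a1 a2; move: (N%:R) (C%:R) (Gc%:R) (h%:R : R) => u1 u2 u3 u4 a1 a2; lra.
have m0 : (0 < m)%N by rewrite muln_gt0.
pose M := (eps * N%:R / 2) ^+ 2.
have M0 : 0 < M by rewrite exprn_gt0//; lra.
pose x k w := chain (@clique N) b 2^-1 U (idle_state N) k w.
pose E1 := [set w | 4 * (half_count U m w)%:R <= m%:R :> R].
pose E2 g := [set w | M <= lyap R (x (g * h)%N w)].
have [mE1 prE1] := half_count_small hU m0.
have mE2 g : measurable (E2 g) := (pr_lyap n (g * h) M0).1.
have prE2 g : pr P (E2 g) <= (1 + (g * h)%:R) / M := (pr_lyap n (g * h) M0).2.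
pose E := E1 `|` \big[setU/set0]_(g <- iota 0 Gc) E2 g.
have mE : measurable E by apply: measurableU => //; apply: bigsetU_measurable.
apply: (@le_trans _ _ (P E)); last first.
  rewrite prE// lee_fin; apply: le_trans DN.
  apply: le_trans (pr_setU _ mE1 _) _; first exact: bigsetU_measurable.
  rewrite /D mulrDl; apply: lerD.
    apply: le_trans prE1 _; rewrite ler_pM2l// lef_pV2 ?posrE ?ltr0n//.
    by rewrite ler_nat leq_pmulr.
  apply: le_trans (pr_bigsetU _ _ mE2) _.
  apply: (@le_trans _ _ (\sum_(g <- iota 0 Gc) (8 * Gc%:R / eps ^+ 2) / N%:R)).
    rewrite big_seq [leRHS]big_seq; apply: ler_sum => g; rewrite mem_iota add0n => /andP[_ gG].
    apply: le_trans (prE2 g) _; rewrite ler_pdivrMr//.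
    have gh : (g * h)%:R <= Gc%:R * N%:R :> R.
      rewrite natrM; apply: ler_pM => //; first by rewrite ler_nat ltnW.
      apply: le_trans h1 _; have := ler_wpM2r (ltW Ngt0) eps4.
      by move: (N%:R : R) Ngt0 => u1 u1_gt0 a1; lra.
    rewrite (_ : _ * M = 2 * (Gc%:R * N%:R)); last first.
      rewrite /M; field; apply/andP; split; rewrite gt_eqF//.
    have : 1 <= Gc%:R * N%:R :> R by rewrite -natrM ler1n muln_gt0.
    move: gh; move: (g * h)%:R (Gc%:R * N%:R) => u v uv v1; lra.
  rewrite big_const_seq count_predT iter_addr_0 size_iota -[_ *+ _]mulr_natl.
  by rewrite mulrA.
apply: hP => w [t [/andP[t0 tm] Hw]].
have [//|nE] := pselect (E w); exfalso.
have nE1 : m%:R < 4 * (half_count U m w)%:R :> R.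
  by rewrite ltNge; apply/negP => hE; apply: nE; left.
have nE2 g : (g < Gc)%N -> lyap R (x (g * h)%N w) < M.
  move=> gG; rewrite ltNge; apply/negP => hE; apply: nE; right.
  have gi : g \in iota 0 Gc by rewrite mem_iota.
  by rewrite -bigcup_seq; exists g; [exact: gi|exact: hE].
have tT : t < event_time N 2^-1 U m w.
  apply: le_lt_trans tm _; rewrite /event_time -mulr_suml ltr_pdivlMr; last first.
    by rewrite mulr_gt0// addr_gt0.
  apply: lt_le_trans (half_count_ge U_itv m w).
  rewrite /m natrM in nE1.
  have a1 : N%:R * (12 * tmax) < N%:R * C%:R by rewrite ltr_pM2l.
  exact: (alg _ _ _ _ a1 nE1).
have km := nevents_lt U_itv (isT : 0 < N)%N lam0 m0 tT.
move: Hw; rewrite /qproc; set k := nevents _ _ _ _ _ in km *; rewrite qfrac_cnt -/(x k w).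
have [|c2 c1] := @path_close R n b b0 (fun k => x k w) _ eps h Gc eps_gt0 eps4 h0 h1 nE2 k (leq_trans km mG).
  move=> j; exists (mark U n 2^-1 j w).
  by rewrite /x !chain_zproc.
case: i => [|[|i]].
- by rewrite cnt0 /fluid mulfV ?gt_eqF// subrr normr0 ltNge (ltW eps0_gt0).
- rewrite /fluid (_ : _ - 2^-1 = ((cnt 1 (x k w))%:R - N%:R / 2) / N%:R); last first.
    by rewrite mulrBl mulrAC mulfV ?gt_eqF// mul1r.
  rewrite normrM normfV (gtr0_norm Ngt0) ltr_pdivlMr// ltNge (le_trans c1)//.
  by rewrite ler_pM2r.
- by rewrite /fluid cnt_ge2_eq0// mul0r subr0 normr0 ltNge (ltW eps0_gt0).
Qed.

End CliqueFluid.

(** * The deviation on the graph *)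

Lemma limn_esup_gt0 (R : realType) (u : nat -> R) :
  (0 < limn_esup (fun N => (u N)%:E))%E ->
  exists2 a, 0 < a & forall N0, exists2 N, (N0 <= N)%N & a <= u N.
Proof.
move=> h; apply: contrapT => hn; move: h; apply/negP; rewrite -leNgt.
apply/lee_addgt0Pr => e e0; rewrite add0e.
have [N0 hN0] : exists N0, forall N, (N0 <= N)%N -> u N < e.
  apply: contrapT => hN0; apply: hn; exists e => // N0.
  apply: contrapT => hN; apply: hN0; exists N0 => N NN.
  by rewrite ltNge; apply/negP => eu; apply: hN; exists N.
apply: (@le_trans _ _ (ereal_sup ((fun N => (u N)%:E) @` [set N | (N0 <= N)%N]))).
  by apply: ereal_inf_lbound; exists [set N | (N0 <= N)%N] => //; exists N0.
apply: ge_ereal_sup => _ [N NN <-]; rewrite lee_fin ltW//; exact: hN0.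
Qed.

Lemma frac_low_degreeE (R : realType) (G : forall N, rel 'I_N) M N :
  frac_low_degree G M N R = (\sum_(v < N) (degree (G N) v <= M))%N%:R / N%:R.
Proof.
rewrite /frac_low_degree; congr (_%:R / _).
rewrite -sum1_card big_mkcond; apply: eq_bigr => v _.
rewrite (_ : (v \in _) = (degree (G N) v <= M)%N); first by case: (_ <= _)%N.
by apply/idP/idP => [/set_mem//|h]; exact/mem_set.
Qed.

Lemma sum1_seq (I : finType) (s : seq I) : uniq s -> (\sum_(v | v \in s) 1 = size s)%N.
Proof. by move=> us; rewrite sum1_card; apply/card_uniqP. Qed.

Lemma leq_half_div (N K : nat) : (0 < K)%N -> (4 * K <= N)%N ->
  (N <= 4 * K * (N./2 %/ K))%N.
Proof.
move=> K0 KN; have := ltn_ceil N./2 K0; rewrite mulSn.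
have : (N <= (N./2).*2.+1)%N by rewrite -{1}(odd_double_half N); case: (odd N).
rewrite mulnAC -mulnA; move: (N./2 %/ K * K)%N => x; move: (N./2) => h; lia.
Qed.

(* A set of [N./2] servers containing the neighborhoods of linearly many low-degree servers. *)
Lemma full_neighborhoods (N : nat) (G : rel 'I_N) (M : nat) :
  exists AS : pred 'I_N * pred 'I_N,
  [/\ (\sum_(v | AS.1 v) 1 = N./2)%N, (forall v, AS.2 v -> (degree G v <= M)%N),
      (forall v w, AS.2 v -> nbhd G v w -> AS.1 w) &
      (\sum_(v | AS.2 v) 1 = minn (\sum_v (degree G v <= M)) (N./2 %/ M.+1))%N].
Proof.
pose low := [seq v <- enum 'I_N | (degree G v <= M)%N].
pose t := (N./2 %/ M.+1)%N.
pose s := take t low.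
have us : uniq s by rewrite take_uniq// filter_uniq// enum_uniq.
have slow v : v \in s -> (degree G v <= M)%N.
  by move/mem_take; rewrite mem_filter => /andP[].
have sz : size s = minn (\sum_v (degree G v <= M)) t.
  rewrite size_take_min minnC size_filter -sum1_count big_enum_cond /=.
  by congr minn; rewrite [LHS]big_mkcond; apply: eq_bigr => v _; case: (_ <= M)%N.
pose B := [pred w | has (fun v => nbhd G v w) s].
have cB : (count B (enum 'I_N) <= N./2)%N.
  rewrite -sum1_count big_enum_cond /= big_mkcond.
  apply: (@leq_trans (\sum_w \sum_(v <- s) nbhd G v w)%N).
    apply: leq_sum => w _; case: ifP => // /hasP[v vs nvw].
    by rewrite (bigD1_seq v)//= nvw.
  rewrite exchange_big /=; apply: (@leq_trans (\sum_(v <- s) M.+1)%N).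
    rewrite big_seq [leqRHS]big_seq; apply: leq_sum => v vs.
    by apply: leq_trans (nbhd_le G v) _; rewrite ltnS slow.
  rewrite big_const_seq count_predT iter_addn_0 sz mulnC.
  apply: (@leq_trans (t * M.+1)%N); first by rewrite leq_mul2r geq_minr orbT.
  exact: leq_divM.
(* Listing [B] before its complement puts [B], which has at most [N./2] elements, inside the first
   [N./2] entries. *)
pose l := seq.filter B (enum 'I_N) ++ seq.filter (predC B) (enum 'I_N).
have pl : perm_eq l (enum 'I_N) by apply/permPl; exact: perm_filterC.
have ul : uniq l by rewrite (perm_uniq pl) enum_uniq.
have sl : size l = N by rewrite (perm_size pl) size_enum_ord.
exists (fun v => v \in take N./2 l, fun v => v \in s) => /=; split.
- by rewrite sum1_seq ?take_uniq// size_takel// sl -divn2 leq_div.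
- exact: slow.
- move=> v w vs nvw; rewrite /l take_cat size_filter.
  have wB : w \in seq.filter B (enum 'I_N).
    by rewrite mem_filter mem_enum andbT; apply/hasP; exists v.
  case: ltnP => h; last by rewrite mem_cat wB.
  by have := leq_trans h cB; rewrite ltnn.
- by rewrite sum1_seq.
Qed.

Lemma cvg_inv_rate (R : realType) (u : nat -> R) (l : R) :
  (forall N, (0 < N)%N -> `|u N - l| <= N%:R^-1) -> u @ \oo --> l.
Proof.
move=> h; apply/cvgrPdist_le => e e0.
exists (Num.truncn e^-1).+1 => // N /= hN; rewrite distrC.
have N0 : (0 < N)%N by apply: leq_trans hN.
apply: le_trans (h N N0) _; rewrite invf_ple ?posrE ?ltr0n//.
by apply: le_trans (ltW (truncnS_gt _)) _; rewrite ler_nat.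
Qed.

Lemma qfrac_indic_cvg (R : realType) (A : forall N, pred 'I_N) (i : nat) :
  (forall N, (\sum_(v | A N v) 1 = N./2)%N) ->
  (fun N => qfrac R i (indic_state (A N))) @ \oo --> fluid R i.
Proof.
move=> hA; apply: cvg_inv_rate => N N0; rewrite qfrac_cnt.
have N0' : 0 < N%:R :> R by rewrite ltr0n.
case: i => [|[|i]].
- by rewrite cnt0 mulfV ?gt_eqF// subrr normr0 invr_ge0.
- rewrite cnt1_indic hA /fluid (_ : _ - _ = ((N./2)%:R - N%:R / 2) / N%:R); last first.
    by rewrite mulrBl mulrAC mulfV ?gt_eqF// mul1r.
  rewrite normrM normfV (gtr0_norm N0') ler_piMl ?invr_ge0//.
  have -> : N%:R = (odd N)%:R + 2 * (N./2)%:R :> R.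
    by rewrite -{1}(odd_double_half N) natrD -mul2n natrM.
  rewrite ler_norml; move: (N./2%:R) => y; case: (odd N) => /=; apply/andP; split; lra.
- by rewrite cnt2_indic mul0r subr0 normr0 invr_ge0.
Qed.

(** For [k = x m] the gain per server is [s x / 3 - 3 x^2 / 2], maximal at [x = s / 9], whence the
    choice of [k]. Rounding still leaves [x >= s / 18], with gain at least [s^2 / 72]. The parity
    term is at most [s^2 / 486] because [18 <= s m], so [s^2 / 216] remains. *)
Lemma deficit_arith (R : realType) (m s c k S : R) : 0 < m -> 0 < s -> 2 * c <= m ->
  s * m <= S -> 18 <= s * m -> k <= s * m / 9 -> s * m / 18 <= k ->
  c - k * S / (3 * m) + k / (3 * m) + 3 / 2 * k ^+ 2 / m <= m * (1 / 2 - s ^+ 2 / 216).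
Proof.
move=> m0 s0 cm smS sm k1 k2.
have k0 : 0 <= k by lra.
have i0 : 0 <= m^-1 by rewrite invr_ge0 ltW.
have mi : s * m * m^-1 = s by rewrite mulfK// gt_eqF.
have h1 : s <= S * m^-1 by rewrite -{1}mi ler_wpM2r.
have h2 : k * m^-1 <= s / 9 by rewrite -{1}mi mulrAC ler_wpM2r.
have h3 : 18 * m^-1 <= s by rewrite -[leRHS]mi ler_wpM2r.
have h1' := ler_wpM2l k0 h1; have h2' := ler_wpM2l k0 h2; have h3' := ler_wpM2l k0 h3.
have h4 := ler_wpM2l (ltW s0) k2.
rewrite invfM !expr2; move: (m^-1) h1' h2' h3' => i h1' h2' h3'.
by nra.
Qed.

(** * From the expected deficit to a deviation in continuous time *)

Section Deviation.
Context {R : realType} {d : measure_display} {T : measurableType d}.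
Variables (P : probability T R) (U : nat -> T -> R).
Hypothesis hU : iid_uniform P U.
Hypothesis U_itv : forall k w, 0 < U k w < 1.
Variables (b : option nat) (n : nat) (G : rel 'I_n.+1).
Hypothesis b0 : fits b 1.
Local Notation N := n.+1.
Variables (S A : pred 'I_N) (M : nat) (s : R).
Hypothesis A_half : (\sum_(v | A v) 1 = N./2)%N.
Hypothesis S_degree : forall v, S v -> (degree G v <= M)%N.
Hypothesis S_nbhd : forall v w, S v -> nbhd G v w -> A w.
Hypothesis S_le : (2 * ((\sum_(v | S v) 1) * M.+1) <= N)%N.
Hypotheses (s0 : 0 < s) (s1 : s <= 1) (sN : 18 <= s * N%:R).
Hypothesis S_ge : s * N%:R <= (\sum_(v | S v) 1)%N%:R.

Let gap : R := s ^+ 2 / 216.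
Let x0 : state N := indic_state A.

Lemma kiter_cnt1_deficit : exists2 k, (k <= N)%N &
  kiter (@mark_weight R n 2^-1) (@dstep R n G b) k (fun x => (cnt 1 x)%:R) x0
    <= N%:R * (1 / 2 - gap).
Proof.
have N0 : 0 < N%:R :> R by rewrite ltr0n.
have e0 : 0 <= s * N%:R / 9 by rewrite divr_ge0// mulr_ge0// ltW.
have /andP[k1 k2] := truncn_itv e0; move: k1 k2; set k := Num.truncn _ => k1 k2.
exists k.
  rewrite -(ler_nat R); apply: le_trans k1 _.
  have := ler_wpM2r (ltW N0) s1; move: (s * N%:R) (N%:R : R) N0 => u m m0 h; lra.
have c1E : cnt 1 x0 = N./2 by rewrite cnt1_indic.
have hN : N%:R = (odd N)%:R + 2 * (N./2)%:R :> R.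
  by rewrite -{1}(odd_double_half N) natrD -mul2n natrM.
have odd1 : 0 <= ((odd N)%:R : R) <= 1 by case: (odd N); rewrite ?lexx ?ler01.
apply: le_trans (deficit (R := R) b0 S_degree k _ _ _ _) _.
- by rewrite cnt2_indic.
- rewrite /emp big1// => v Sv; rewrite big1// => w nw.
  by rewrite ffunE (S_nbhd Sv nw).
- by rewrite c1E hN addrAC gerDr subr_le0; case/andP: odd1.
- by rewrite -!natrM ler_nat.
rewrite c1E.
(* Since [s N / 9 >= 2], truncation removes at most half of it. *)
have hk : s * N%:R / 18 <= k%:R by move: k2 sN; rewrite -[k.+1%:R]natr1; move: (s * N%:R) => u; lra.
have k0 : 0 <= k%:R :> R by [].
have hh : 2 * (N./2)%:R <= N%:R :> R by rewrite hN lerDr; case/andP: odd1.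
exact: (deficit_arith N0 s0 hh S_ge sN k1 hk).
Qed.

Lemma deviation (tmax : R) : 0 < gap -> 4 / gap <= tmax ->
  exists E, [/\ measurable E, gap / 2 <= pr P E & forall w, E w ->
    exists t, 0 <= t <= tmax /\
      gap / 4 < `|qproc G b 2^-1 U x0 1 t w - 2^-1|].
Proof.
move=> gap0 htmax.
have alg (m j g t : R) : j <= m -> 4 * m <= g * t * m -> j * 2 <= g / 3 * (t * (m * (2^-1 + 1))).
  by lra.
have lam0 : 0 < 2^-1 :> R by rewrite invr_gt0.
have N0 : 0 < N%:R :> R by rewrite ltr0n.
have gap1 : gap <= 1 / 216.
  rewrite /gap ler_pM2r// expr_le1//; exact: ltW.
have [k kN hk] := kiter_cnt1_deficit.
have tmax0 : 0 < tmax by apply: lt_le_trans htmax; rewrite divr_gt0.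
pose X (x : state N) : bool := N%:R * (1 / 2 - gap / 2) <= (cnt 1 x)%:R :> R.
pose s' := tmax * (N%:R * (2^-1 + 1)).
have s'0 : 0 < s' by rewrite /s' !mulr_gt0//; lra.
pose E1 := [set w | X (zproc (@dstep R n G b) (mark U n 2^-1) x0 k w)].
pose E2 := [set w | s' < \sum_(j < k) - ln (U (4 * j)%N w)].
have iM := indep_mark hU U_itv n lam0.
have w0 := mark_weight_ge0 (n := n) lam0.
have w1 := mark_weight_sum n (2^-1 : R).
have mE1 : measurable E1 := measurable_zproc (@dstep R n G b) iM x0 k X.
(* Markov's inequality, with [1/2 - gap <= (1 - gap) (1/2 - gap/2)] because the difference is
   [gap^2 / 2]. *)
have prE1 : pr P E1 <= 1 - gap.
  have M0 : 0 < N%:R * (1 / 2 - gap / 2) by rewrite mulr_gt0//; lra.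
  apply: (le_trans (@pr_zproc_markov _ _ _ _ (@dstep R n G b) w0 w1 _ _ _ _ iM
    x0 k X (fun x => (cnt 1 x)%:R) _ M0 (fun x => ler0n _ _) (fun z h => h))).
  rewrite ler_pdivrMr//; apply: le_trans hk _.
  rewrite mulrCA ler_pM2l//.
  by have := sqr_ge0 gap; lra.
have mE2 : measurable E2 := measurable_event_sum hU k s'.
(* Each of the [k <= N] waiting terms has mean at most 2, so event [k] misses the horizon with
   probability at most [4 / (3 tmax) <= gap / 3]. *)
have prE2 : pr P E2 <= gap / 3.
  apply: le_trans (event_time_upper hU U_itv k s'0) _.
  rewrite ler_pdivrMr// /s'.
  have h1 : 4 <= gap * tmax by rewrite mulrC -ler_pdivrMr.
  have h2 : k%:R <= N%:R :> R by rewrite ler_nat.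
  have h3 := ler_wpM2r (ltW N0) h1.
  exact: (alg _ _ _ _ h2 h3).
exists (~` (E1 `|` E2)); split.
- by apply: measurableC; exact: measurableU.
- rewrite prC; last exact: measurableU.
  have := pr_setU P mE1 mE2; lra.
move=> w; rewrite /= => hw.
have hE1 : ~ E1 w by move=> h; apply: hw; left.
have hE2 : ~ E2 w by move=> h; apply: hw; right.
have rate0 : 0 < N%:R * (2^-1 + 1) :> R by rewrite mulr_gt0//; lra.
have sum0 : 0 <= \sum_(j < k) - ln (U (4 * j)%N w).
  by rewrite sumr_ge0// => j _; apply/ltW/NlnU_gt0.
(* The time may depend on [w]: at the moment of event [k] exactly [k] events have occurred. *)
exists (event_time N 2^-1 U k w); split.
  rewrite /event_time -mulr_suml; apply/andP; split; first by rewrite divr_ge0// ltW.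
  by rewrite ler_pdivrMr// leNgt; apply/negP.
rewrite /qproc (nevents_eq U_itv _ lam0 (n := k)) ?lexx ?event_time_ltS//.
rewrite qfrac_cnt (chain_zproc U_itv); move/negP: hE1; rewrite /X -ltNge => hE1.
set q := (cnt 1 _)%:R in hE1 *.
have h1 : q / N%:R < 1 / 2 - gap / 2 by rewrite ltr_pdivrMr// mulrC.
rewrite distrC; apply: lt_le_trans (ler_norm _).
by move: (q / N%:R) h1 => v h1; lra.
Qed.

End Deviation.

Unset Implicit Arguments.

Theorem theorem4p1 (R : realType) (b : option nat) (G : forall N, rel 'I_N) :
  (forall c, b = Some c -> (0 < c)%N) ->
  (forall N, (1 <= N)%N -> simple_graph (G N)) ->
  (exists M : nat, (0 < limn_esup (fun N => (frac_low_degree G M N R)%:E))%E) ->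
  ~ N_optimal R b G.
Proof.
move=> hb _ [M /limn_esup_gt0[a a0 ha]] opt.
have b0 : fits b 1 by move: hb; case: b {opt} => //= c; exact.
have [d [T [P [U [hP hU U_itv]]]]] := exists_iid_uniform R.
pose AS N := projT1 (cid (full_neighborhoods (G N) M)).
have hAS N := projT2 (cid (full_neighborhoods (G N) M)).
pose x0 N := indic_state (AS N).1.
have fits1 N (A : pred 'I_N) v : fits b (indic_state A v).
  by move: b0; rewrite ffunE; case: b {hb opt} => //= c; case: (A v).
(* The size of [S] is a minimum of two numbers: the low-degree servers give the fraction [a] along a
   subsequence, and the room for their neighborhoods gives [1 / (4 (M + 1))] once
   [N >= 4 (M + 1)]. *)
pose s := Num.min a (1 / (4 * M.+1%:R)) : R.
have s0 : 0 < s by rewrite lt_min a0 divr_gt0// mulr_gt0.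
have sa : s <= a by rewrite ge_min lexx.
have sM : s * (4 * M.+1%:R) <= 1.
  by rewrite -ler_pdivlMr ?mulr_gt0// ge_min lexx orbT.
have s1 : s <= 1.
  apply: le_trans sM; rewrite ler_peMr ?(ltW s0)// -natrM ler1n muln_gt0//.
pose gap := s ^+ 2 / 216.
have gap0 : 0 < gap by apply: divr_gt0 => //; apply: exprn_gt0.
have lam01 : 0 < (2^-1 : R) < 1 by apply/andP; split; lra.
have tmax0 : 0 <= 4 / gap by rewrite divr_ge0// ltW.
have eps0 : 0 < gap / 4 by lra.
have := opt _ lam01 _ _ P U hU x0 (fun N => idle_state N) (fluid R) (fun i _ => fluid R i)
  (fun N v => fits1 N _ v) (fun N v => fits1 N _ v) _ _ _ (clique_fluid hP hU U_itv b0)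
  1%N (4 / gap) (gap / 4) (gap / 4) tmax0 eps0 eps0.
case.
- by move=> i; apply: qfrac_indic_cvg => N; have [] := hAS N.
- by move=> i; apply: qfrac_indic_cvg => N; exact: sum_ltn_half.
- by move=> i; exact: cst_continuous.
move=> N0 _ hN0.
(* The upper limit supplies only infinitely many [N], whereas convergence holds for all large ones;
   a single [N] beyond every threshold suffices. *)
have [N] := ha (maxn N0 (maxn (4 * M.+1) (Num.truncn (18 / s)).+1)).
rewrite !geq_max => /and3P[hN1 hN2 hN3] haN.
have Npos : (0 < N)%N by apply: leq_trans hN2; rewrite muln_gt0.
have := hN0 N hN1; case: N Npos hN1 hN2 hN3 haN => // n _ _ hN2 hN3 haN.
set N := n.+1 in hN2 hN3 haN *.
have NR : 0 < N%:R :> R by rewrite ltr0n.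
have [A_half S_deg S_nb S_card] := hAS N.
have S_le : (2 * ((\sum_(v | (AS N).2 v) 1) * M.+1) <= N)%N.
  rewrite S_card; apply: (@leq_trans (2 * N./2)%N).
    rewrite leq_mul2l /=; apply: leq_trans (leq_divM N./2 M.+1).
    by rewrite leq_mul2r geq_minr orbT.
  by rewrite mul2n -{2}(odd_double_half N) leq_addl.
have sN : 18 <= s * N%:R.
  rewrite mulrC -ler_pdivrMr//; apply: le_trans (ltW (truncnS_gt _)) _.
  by rewrite ler_nat.
have S_ge : s * N%:R <= (\sum_(v | (AS N).2 v) 1)%N%:R :> R.
  rewrite S_card /minn; case: ifP => _.
    move: haN; rewrite frac_low_degreeE ler_pdivlMr//; apply: le_trans.
    by rewrite ler_pM2r.
  have M0 : 0 < 4 * M.+1%:R :> R by rewrite mulr_gt0.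
  rewrite -(ler_pM2r M0) mulrAC; apply: le_trans (ler_wpM2r (ltW NR) sM) _.
  by rewrite mul1r -!natrM ler_nat mulnC leq_half_div.
have [E [mE prE' hE]] := deviation hU U_itv b0 A_half S_deg S_nb S_le s0 s1 sN S_ge gap0 (lexx _).
move=> hbad.
have : (P E <= (gap / 4)%:E)%E.
  by apply: le_trans hbad; apply: hP => w /hE.
rewrite prE// lee_fin leNgt => /negP; apply.
by apply: lt_le_trans prE'; rewrite ltr_pM2l// ltf_pV2 ?posrE//; lra.
Qed.
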